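(* Let $k\geq 0$ be an integer, $\beta\in\mathbb{C}$ a constant, $\gamma$ a real constant with $0\leq\gamma<1$, and let $a(z)$ and $\alpha(z)$ be meromorphic functions on $\mathbb{C}$. Consider the differential-difference equation $$f^2(z)+a(z)f^{(k)}(z+\beta)=\alpha(z),$$ where $a(z)$ is a small function of $f(z)$ and $T(r,\alpha)=\gamma T(r,f)+S(r,f)$. Then there does not exist a finite order transcendental entire solution $f$ of this equation; that is, there is no transcendental entire function $f$ of finite order which satisfies the equation and for which $a$ is a small function of $f$ and $T(r,\alpha)=\gamma T(r,f)+S(r,f)$.
   Context: $T(r,f)$ is the Nevanlinna characteristic function of a meromorphic function $f$ on $\mathbb{C}$. $S(r,f)$ denotes any quantity that is $o(T(r,f))$ as $r\to\infty$ outside a set of finite linear measure. A meromorphic function $g$ is a small function of $f$ if $T(r,g)=S(r,f)$. The order of $f$ is $\rho(f)=\limsup_{r\to\infty}\frac{\log^+ T(r,f)}{\log r}$. $f^{(k)}$ is the $k$-th derivative, $f^{(0)}=f$, and $f^2(z)=(f(z))^2$. *)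

(* Defs.v *)
From mathcomp Require Import all_boot all_order all_algebra.
From mathcomp Require Import complex.
From mathcomp Require Import all_classical all_reals all_analysis.
Import Order.TTheory GRing.Theory Num.Theory.
Import numFieldNormedType.Exports.
Set Implicit Arguments.
Unset Strict Implicit.
Unset Printing Implicit Defensive.

Local Open Scope classical_set_scope.
Local Open Scope ring_scope.
Local Open Scope complex_scope.

(* These notions are used at K := R[i]. They are stated over an abstract
   numFieldType because the canonical topology and normed module structure of
   a field over itself are attached to numFieldType; at R[i], [derivable] and
   [derive1n] are complex differentiability and the complex derivatives. *)
Section Meromorphic.
Context {K : numFieldType}.
Implicit Types (f g : K -> K) (z : K).

Definition nderiv (k : nat) f : K -> K := derive1n k f.

Definition holomorphic_at f z : Prop := \forall w \near z, derivable f w 1.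

Definition entire f : Prop := forall z, derivable f z 1.

Definition transcendental_entire f : Prop :=
  entire f /\ ~ exists p : {poly K}, forall z, f z = p.[z].

(* Pole of order n, where n >= 1. *)
Definition pole f z (n : nat) : Prop :=
  (0 < n)%N /\ exists g, [/\ holomorphic_at g z, g z != 0 &
    \forall w \near z^', f w = g w / (w - z) ^+ n].

(* A meromorphic function is represented by a total function whose values at
   its poles are irrelevant; identities between meromorphic functions must
   therefore only be asserted away from the poles. *)
Definition meromorphic f : Prop :=
  forall z, holomorphic_at f z \/ exists n, pole f z n.

(* 0 when z is not a pole. *)
Definition pole_order f z : nat := xget 0%N [set n | pole f z n].

End Meromorphic.

Section Nevanlinna.
Context {R : realType}.
Implicit Types (f g : R[i] -> R[i]) (r : R).

(* [ln] vanishes outside of the positive reals, so that log^+ 0 = 0. *)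
Definition logp (x : R) : R := Num.max 0 (ln x).

(* m(r, f) *)
Definition proximity f r : R :=
  (2 * pi)^-1 * \int[lebesgue_measure]_(t in `[0, 2 * pi])
                   logp (Normc.normc (f ((r * cos t) +i* (r * sin t)))).

(* n(r, f): the number of poles in the closed disc, with multiplicity *)
Definition pole_count f r : R :=
  \sum_(z \in [set z | Normc.normc z <= r]) ((pole_order f z)%:R : R).

(* N(r, f) *)
Definition pole_counting f r : R :=
  \int[lebesgue_measure]_(t in `]0, r]) ((pole_count f t - pole_count f 0) / t)
  + pole_count f 0 * ln r.

(* T(r, f) *)
Definition characteristic f r : R := proximity f r + pole_counting f r.

Definition order_of_growth f : \bar R :=
  limf_esup (fun r => (logp (characteristic f r) / ln r)%:E) +oo%R.

(* The quantity q(r) is an S(r, f). *)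
Definition is_S f (q : R -> R) : Prop :=
  exists E : set R, [/\ measurable E, (lebesgue_measure E < +oo)%E &
    forall e : R, 0 < e -> \forall r \near +oo, ~ E r ->
      `|q r| <= e * `|characteristic f r| ].

(* g is a small function of f. *)
Definition small_function f g : Prop :=
  meromorphic g /\ is_S f (characteristic g).

End Nevanlinna.

(* Main.v *)
Require Import Defs.
From mathcomp Require Import all_boot all_order all_algebra complex.
From mathcomp Require Import all_classical all_reals all_analysis.
From mathcomp Require Import ring lra.
Import Order.TTheory GRing.Theory Num.Theory.
Import numFieldNormedType.Exports.
Set Implicit Arguments.
Unset Strict Implicit.
Unset Printing Implicit Defensive.
Local Open Scope classical_set_scope.
Local Open Scope ring_scope.
Local Open Scope complex_scope.

(** Since [f] is entire, [T(r,f) = m(r,f)], and the equation gives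
    [2 log^+|f(z)| <= log^+|alpha(z)| + log^+|a(z)| + log^+|f^(k)(z + beta)| + log 2].
    No logarithmic derivative lemma is needed: for [s > r] the function [log^+|f| - 1] has,
    on the disc of radius [s], a nonnegative harmonic majorant whose circle means are all
    [m(s,f)] (the real part of a Schwarz integral, by the maximum principle).  Cauchy's
    estimate bounds [f^(k)(z + beta)] by the maximum of [|f|] on a disc of fixed radius
    around [z], and by Harnack's inequality the majorant varies there by a factor at most
    [K] as soon as [s - r >= c(K)].  Averaging over [|z| = r] yields
    [2 T(r,f) <= (gamma + 2 e) T(r,f) + K T(s,f) + O(1)]
    for every [r] outside an exceptional set and every [s >= r + c(K)].  Choosing radii
    [r_n] in a linearly growing sequence that avoids the exceptional set, [T(r_n,f)] grows
    geometrically in [n], which contradicts finite order. *)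

(** The only gain is the excess of [2 - gamma] over 1, so the losses from shift and differentiation
    must be factors close to 1. Harnack's factor tends to 1 as the gap [s - r] grows, and a wide but
    fixed gap is affordable: geometric growth along radii that increase linearly contradicts finite
    order, however large the step. Of the two factors in [K ^+ 2 <= 2 - gamma - 2 * e], one pays for
    the Harnack constant in front of [T(s, f)] and the other is the growth rate per step.
    Transcendence starts the iteration: by Harnack and Liouville, bounded circle means would make
    [f] constant. All complex analysis is derived from Goursat's theorem on rectangles. Composition
    with the exponential turns circles into vertical segments, so only means over circles centred at
    0 are needed, never general contour integrals. *)

(** * Holomorphy and continuity over a numFieldType *)

Section AbstractField.
Context {K : numFieldType}.
Implicit Types (f g : K -> K) (z w : K).

(* Stated over an abstract [numFieldType], which carries the topology of [R[i]], and wrapped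
   in [Variant]s so that unification does not unfold filters on [R[i]]. *)
Variant holo f z : Prop := Holo of derivable f z 1.
Variant ccont f z : Prop := Ccont of {for z, continuous f}.
Definition knear z (P : K -> Prop) : Prop := \forall w \near z, P w.
Definition kdnear z (P : K -> Prop) : Prop := \forall w \near z^', P w.
Definition cder f : K -> K := derive1 f.

Lemma holo_ccont f z : holo f z -> ccont f z.
Proof. by case=> /derivable1_diffP/differentiable_continuous. Qed.

Lemma holo_cst (c : K) z : holo (fun=> c) z.
Proof. by constructor; exact: derivable_cst. Qed.

Lemma holo_id z : holo id z.
Proof. by constructor; exact: derivable_id. Qed.

Lemma holoB f g z : holo f z -> holo g z -> holo (fun w => f w - g w) z.
Proof. by case=> Hf [Hg]; constructor; exact: derivableB. Qed.

Lemma holoN f z : holo f z -> holo (fun w => - f w) z.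
Proof. by case=> Hf; constructor; exact: derivableN. Qed.

Lemma holoM f g z : holo f z -> holo g z -> holo (fun w => f w * g w) z.
Proof. by case=> Hf [Hg]; constructor; exact: derivableM. Qed.

Lemma holoV f z : f z != 0 -> holo f z -> holo (fun w => (f w)^-1) z.
Proof. by move=> fz [Hf]; constructor; exact: derivableV. Qed.

Lemma holoX f n z : holo f z -> holo (fun w => f w ^+ n) z.
Proof.
move=> Hf; elim: n => [|n IHn].
  by under eq_fun do rewrite expr0; exact: holo_cst.
by under eq_fun do rewrite exprS; exact: holoM.
Qed.

Lemma holo_comp f g z : holo g z -> holo f (g z) -> holo (fun w => f (g w)) z.
Proof.
case=> /derivable1_diffP dg [/derivable1_diffP df]; constructor.
apply/derivable1_diffP.
exact: differentiable_comp.
Qed.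

Lemma ccontM f g z : ccont f z -> ccont g z -> ccont (fun w => f w * g w) z.
Proof. by case=> Hf [Hg]; constructor; exact: (cvgM Hf Hg). Qed.
Section param.
Context {T : topologicalType}.
Implicit Types (F G : T -> K).
Variant kcont F (t : T) : Prop := Kcont of {for t, continuous F}.
Lemma kcont_comp f F t : kcont F t -> ccont f (F t) -> kcont (fun s => f (F s)) t.
Proof. by case=> Hf [Hg]; constructor; exact: continuous_comp. Qed.

Lemma kcontD F G t : kcont F t -> kcont G t -> kcont (fun s => F s + G s) t.
Proof. by case=> Hf [Hg]; constructor; exact: (cvgD Hf Hg). Qed.

Lemma kcontB F G t : kcont F t -> kcont G t -> kcont (fun s => F s - G s) t.
Proof. by case=> Hf [Hg]; constructor; exact: (cvgB Hf Hg). Qed.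

Lemma kcontM F G t : kcont F t -> kcont G t -> kcont (fun s => F s * G s) t.
Proof. by case=> Hf [Hg]; constructor; exact: (cvgM Hf Hg). Qed.

Lemma kcontV F t : F t != 0 -> kcont F t -> kcont (fun s => (F s)^-1) t.
Proof. by move=> fz [Hf]; constructor; exact: (cvgV fz Hf). Qed.

Lemma kcont_cst (c : K) t : kcont (fun=> c) t.
Proof. constructor; exact: (@cst_continuous T K c t). Qed.

Lemma kcontP F t : kcont F t <-> forall e : K, 0 < e -> \forall s \near t, `|F s - F t| < e.
Proof.
split=> [[cF] e e0|H].
  by have /cvgrPdist_lt/(_ e e0) := cF; apply: filterS => s; rewrite distrC.
constructor; suff : F s @[s --> t] --> F t by [].
by apply/(@cvgrPdist_lt _ _ _ (nbhs t)) => e /H; apply: filterS => s; rewrite distrC.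
Qed.
End param.

Lemma near_eq_holo f g z : (\forall w \near z, f w = g w) -> holo f z -> holo g z.
Proof. by move=> fg [Hf]; constructor; exact: near_eq_derivable fg Hf. Qed.

Lemma nbhs_norm z (P : K -> Prop) :
  (\forall w \near z, P w) <-> exists2 e : K, 0 < e & forall w, `|w - z| < e -> P w.
Proof.
split => [/nbhs_ballP[e /= e0 He]|[e e0 He]].
  by exists e => // w wz; apply: He; rewrite -ball_normE /= distrC.
apply/nbhs_ballP; exists e => //= w; rewrite -ball_normE /= distrC; exact: He.
Qed.

Lemma dnbhs_norm z (P : K -> Prop) :
  (\forall w \near z^', P w) <->
  exists2 e : K, 0 < e & forall w, w != z -> `|w - z| < e -> P w.
Proof.
rewrite /dnbhs /within /=; split => [/nbhs_norm[e e0 He]|[e e0 He]].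
  by exists e => // w wz we; exact: He.
by apply/nbhs_norm; exists e => // w we wz; exact: He.
Qed.

Lemma holo_approx f z : holo f z -> forall e : K, 0 < e ->
  exists2 d : K, 0 < d & forall w, `|w - z| < d ->
    `|f w - f z - cder f z * (w - z)| <= e * `|w - z|.
Proof.
case=> df e e0.
have /cvgrPdist_le/(_ e e0)/dnbhs_norm[d d0 Hd] : (fun h => h^-1 *: ((f (h + z)) - f z)) @ 0^' --> cder f z.
  by rewrite /cder derive1E; have := df; rewrite /derivable /derive => H;
   under eq_fun do rewrite -[X in f (X + z)]mulr1.
exists d => // w wd; have [->|wz] := eqVneq w z; first by rewrite !subrr mulr0 subr0 normr0 mulr0.
have := Hd (w - z); rewrite subr_eq0 subr0 subrK => /(_ wz wd) /(ler_wpM2r (normr_ge0 (w-z))).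
rewrite -normrM; congr (_ <= _); rewrite -normrN; congr `| _ |.
rewrite mulrBl /GRing.scale/= mulrAC mulVf ?subr_eq0// mul1r; ring.
Qed.

(** The first-order expansion gives existence and value of the derivative at once. Through [nc_holo]
    it identifies the derivatives of [cexp] and of parametrized means. *)
Lemma holoP f z l : (forall e : K, 0 < e ->
  exists2 d : K, 0 < d & forall w, `|w - z| < d ->
    `|f w - f z - l * (w - z)| <= e * `|w - z|) -> holo f z /\ cder f z = l.
Proof.
move=> H.
have K1 : (fun h => h^-1 *: ((f (h + z)) - f z)) @ 0^' --> l.
  apply/cvgrPdist_le => e e0; have [d d0 Hd] := H e e0.
  apply/dnbhs_norm; exists d => // h h0; rewrite subr0 => hd.
  have := Hd (h + z); rewrite addrK => /(_ hd).
  have h1 : 0 < `|h| by rewrite normr_gt0.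
  rewrite -[leLHS](divfK (lt0r_neq0 h1)) ler_pM2r// -normf_div -normrN; congr (`| _ | <= _).
  rewrite /GRing.scale/=; field => //.
have K2 : (fun h => h^-1 *: ((f \o shift z) (h *: 1) - f z)) @ 0^' --> l.
  by rewrite [X in X @ _](_ : _ = (fun h => h^-1 *: ((f (h + z)) - f z)))//;
    apply/funext => h /=; rewrite /GRing.scale/= mulr1.
split; first by constructor; apply/cvg_ex; exists l.
by rewrite /cder derive1E /derive; exact: cvg_lim.
Qed.

Lemma ccont_norm f z : ccont f z -> forall e : K, 0 < e ->
  exists2 d : K, 0 < d & forall w, `|w - z| < d -> `|f w - f z| < e.
Proof.
case=> cf e e0; apply/nbhs_norm.
have /cvgrPdist_lt/(_ e e0) := cf; apply: filterS => w.
by rewrite distrC.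
Qed.

Lemma norm_ccont f z : (forall e : K, 0 < e ->
  exists2 d : K, 0 < d & forall w, `|w - z| < d -> `|f w - f z| < e) -> ccont f z.
Proof.
move=> H; constructor; suff: f w @[w --> z] --> f z by [].
apply/(@cvgrPdist_lt _ _ _ (nbhs z)) => e e0; apply/nbhs_norm.
by have [d d0 Hd] := H e e0; exists d => // w /Hd; rewrite distrC.
Qed.

Lemma is_derive_holo f z l : is_derive z 1 f l -> holo f z /\ cder f z = l.
Proof. by case=> df <-; split; [constructor | rewrite /cder derive1E]. Qed.

Lemma derivable_holo f z : derivable f z 1 <-> holo f z.
Proof. by split => [H|[]//]; constructor. Qed.
End AbstractField.

(** * The complex modulus *)

Local Notation Re := complex.Re.
Local Notation Im := complex.Im.
Local Notation nc := Normc.normc.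

Section ComplexNorm.
Context {R : realType}.
Local Notation C := R[i].
Implicit Types (z w : C) (x y : R).

Lemma nc_ge0 z : 0 <= nc z.
Proof. by case: z => a b; exact: sqrtr_ge0. Qed.

Lemma normE z : `|z| = (nc z)%:C.
Proof. by case: z. Qed.

Lemma nc_real x : nc x%:C = `|x|.
Proof. by rewrite /= expr0n/= addr0 sqrtr_sqr. Qed.

Lemma ncM z w : nc (z * w) = nc z * nc w.
Proof. exact: Normc.normcM. Qed.

Lemma nc0 : nc (0 : C) = 0.
Proof. exact: Normc.normc0. Qed.

Lemma nc1 : nc (1 : C) = 1.
Proof. exact: Normc.normc1. Qed.

Lemma ncV z : nc z^-1 = (nc z)^-1.
Proof. exact: Normc.normcV. Qed.

Lemma ncX z n : nc (z ^+ n) = nc z ^+ n.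
Proof. by elim: n => [|n IHn]; rewrite ?expr0 ?nc1// !exprS ncM IHn. Qed.

Lemma ncN z : nc (- z) = nc z.
Proof. exact: normcN. Qed.

Lemma nc_distC z w : nc (z - w) = nc (w - z).
Proof. by rewrite -ncN opprB. Qed.

Lemma ncD z w : nc (z + w) <= nc z + nc w.
Proof. exact: le_normcD. Qed.

Lemma ncB z w : nc (z - w) <= nc z + nc w.
Proof. by rewrite (le_trans (ncD _ _))// ncN. Qed.

Lemma ncB_ge z w : nc z - nc w <= nc (z - w).
Proof. by rewrite lerBlDr (le_trans _ (ncD _ _))// subrK. Qed.

Lemma nc_eq0 z : (nc z == 0) = (z == 0).
Proof.
by apply/eqP/eqP => [/Normc.eq0_normc//|->]; rewrite nc0.
Qed.

Lemma nc_gt0 z : (0 < nc z) = (z != 0).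
Proof. by rewrite lt0r nc_eq0 nc_ge0 andbT. Qed.

Lemma Re_le_nc z : `|Re z| <= nc z.
Proof. by case: z => a b /=; rewrite -sqrtr_sqr ler_sqrt ?lerDl ?addr_ge0 ?sqr_ge0. Qed.

Lemma Im_le_nc z : `|Im z| <= nc z.
Proof. by case: z => a b /=; rewrite -sqrtr_sqr ler_sqrt ?lerDr ?addr_ge0 ?sqr_ge0. Qed.

Lemma nc_le_ReIm z : nc z <= `|Re z| + `|Im z|.
Proof.
case: z => a b /=; rewrite -(ger0_norm (addr_ge0 (normr_ge0 a) (normr_ge0 b))) -sqrtr_sqr ler_sqrt ?sqr_ge0//.
by rewrite sqrrD !real_normK ?num_real// lerD2r lerDl mulrn_wge0// mulr_ge0.
Qed.

Lemma nc_sqr z : nc z ^+ 2 = Re z ^+ 2 + Im z ^+ 2.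
Proof. by case: z => a b /=; rewrite sqr_sqrtr// addr_ge0// sqr_ge0. Qed.

Lemma Re_add z w : Re (z + w) = Re z + Re w. Proof. by case: z; case: w. Qed.

Lemma Im_add z w : Im (z + w) = Im z + Im w. Proof. by case: z; case: w. Qed.

Lemma Re_opp z : Re (- z) = - Re z. Proof. by case: z. Qed.

Lemma Im_opp z : Im (- z) = - Im z. Proof. by case: z. Qed.

Lemma Re_mul z w : Re (z * w) = Re z * Re w - Im z * Im w.
Proof. by case: z; case: w. Qed.

Lemma Im_mul z w : Im (z * w) = Re z * Im w + Im z * Re w.
Proof. by case: z => a b; case: w => c d /=; rewrite addrC. Qed.

Lemma cplx_ext z w : Re z = Re w -> Im z = Im w -> z = w.
Proof. by case: z => a b; case: w => c d /= -> ->. Qed.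

(** In the order of [R[i]] only real numbers are comparable with 0. This turns the epsilons of the
    abstract field into real ones. *)
Lemma posC (e : C) : 0 < e -> exists2 d : R, 0 < d & e = d%:C.
Proof.
case: e => a b; rewrite ltcE /= => /andP[/eqP b0 a0].
by exists a => //; rewrite b0.
Qed.

Lemma near_nc z (P : C -> Prop) :
  knear z P <-> exists2 d : R, 0 < d & forall w, nc (w - z) < d -> P w.
Proof.
split=> [/nbhs_norm[e /posC[d d0 ->] He]|[d d0 Hd]].
  by exists d => // w wd; apply: He; rewrite normE ltcR.
apply/nbhs_norm; exists d%:C; first by rewrite ltcR.
by move=> w; rewrite normE ltcR; exact: Hd.
Qed.

Lemma dnear_nc z (P : C -> Prop) :
  kdnear z P <->
  exists2 d : R, 0 < d & forall w, w != z -> nc (w - z) < d -> P w.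
Proof.
split=> [/dnbhs_norm[e /posC[d d0 ->] He]|[d d0 Hd]].
  by exists d => // w wz wd; apply: He => //; rewrite normE ltcR.
apply/dnbhs_norm; exists d%:C; first by rewrite ltcR.
by move=> w wz; rewrite normE ltcR; exact: Hd.
Qed.

Lemma holo_nc (f : C -> C) z : holo f z -> forall e : R, 0 < e ->
  exists2 d : R, 0 < d & forall w, nc (w - z) < d ->
    nc (f w - f z - cder f z * (w - z)) <= e * nc (w - z).
Proof.
move=> df e e0; have [|d' /posC[d d0 ->] Hd] := holo_approx df (e := e%:C); first by rewrite ltcR.
exists d => // w wd; have := Hd w; rewrite !normE ltcR => /(_ wd).
by rewrite -rmorphM/= lecR.
Qed.

Lemma nc_holo (f : C -> C) z l : (forall e : R, 0 < e ->
  exists2 d : R, 0 < d & forall w, nc (w - z) < d ->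
    nc (f w - f z - l * (w - z)) <= e * nc (w - z)) -> holo f z /\ cder f z = l.
Proof.
move=> H; apply: holoP => e' /posC[e e0 ->].
have [d d0 Hd] := H e e0; exists d%:C; first by rewrite ltcR.
by move=> w; rewrite !normE ltcR -rmorphM/= lecR; exact: Hd.
Qed.

Lemma ccont_nc (f : C -> C) z : ccont f z -> forall e : R, 0 < e ->
  exists2 d : R, 0 < d & forall w, nc (w - z) < d -> nc (f w - f z) < e.
Proof.
move=> cf e e0; have [|d' /posC[d d0 ->] Hd] := ccont_norm cf (e := e%:C); first by rewrite ltcR.
by exists d => // w wd; have := Hd w; rewrite !normE !ltcR; exact.
Qed.

Lemma nc_ccont (f : C -> C) z : (forall e : R, 0 < e ->
  exists2 d : R, 0 < d & forall w, nc (w - z) < d -> nc (f w - f z) < e) -> ccont f z.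
Proof.
move=> H; apply: norm_ccont => e' /posC[e e0 ->].
have [d d0 Hd] := H e e0; exists d%:C; first by rewrite ltcR.
by move=> w; rewrite !normE !ltcR; exact: Hd.
Qed.

Section paths.
Implicit Types (F : R -> C) (t : R).

Lemma kcont_nc F t : kcont F t <-> forall e : R, 0 < e ->
  exists2 d : R, 0 < d & forall s, `|s - t| < d -> nc (F s - F t) < e.
Proof.
split=> [cF e e0|H].
  have eC : (0 : C) < e%:C by rewrite ltcR.
  have /kcontP/(_ _ eC)/nbhs_norm[d d0 Hd] := cF.
  by exists d => // s /Hd; rewrite normE ltcR.
apply/kcontP => e' /posC[e e0 ->]; apply/nbhs_norm.
by have [d d0 Hd] := H e e0; exists d => // s /Hd; rewrite normE ltcR.
Qed.

Lemma rcont_eps (x : R -> R) t : {for t, continuous x} <-> forall e : R, 0 < e ->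
  exists2 d : R, 0 < d & forall s, `|s - t| < d -> `|x s - x t| < e.
Proof.
split=> [cF e e0|H].
  have /cvgrPdist_lt/(_ _ e0)/nbhs_norm[d d0 Hd] := cF.
  by exists d => // s /Hd; rewrite distrC.
suff : x s @[s --> t] --> x t by [].
apply/(@cvgrPdist_lt _ _ _ (nbhs t)) => e e0; apply/nbhs_norm.
by have [d d0 Hd] := H e e0; exists d => // s /Hd; rewrite distrC.
Qed.

Lemma kcont_Re F t : kcont F t -> {for t, continuous (fun s => Re (F s))}.
Proof.
move=> /kcont_nc H; apply/rcont_eps => e /H[d d0 Hd]; exists d => // s /Hd.
by apply: le_lt_trans; rewrite -Re_opp -Re_add Re_le_nc.
Qed.

Lemma kcont_Im F t : kcont F t -> {for t, continuous (fun s => Im (F s))}.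
Proof.
move=> /kcont_nc H; apply/rcont_eps => e /H[d d0 Hd]; exists d => // s /Hd.
by apply: le_lt_trans; rewrite -Im_opp -Im_add Im_le_nc.
Qed.

Lemma kcont_norm F t : kcont F t -> {for t, continuous (fun s => nc (F s))}.
Proof.
move=> /kcont_nc H; apply/rcont_eps => e /H[d d0 Hd]; exists d => // s /Hd.
apply: le_lt_trans; rewrite ler_norml ncB_ge andbT lerNl opprB nc_distC.
exact: ncB_ge.
Qed.

Lemma kcont_ReIm (x y : R -> R) t : {for t, continuous x} -> {for t, continuous y} ->
  kcont (fun s => x s +i* y s) t.
Proof.
move=> /rcont_eps cx /rcont_eps cy; apply/kcont_nc => e e0.
have e2 : 0 < e / 2 by rewrite divr_gt0.
have [d1 d10 H1] := cx _ e2; have [d2 d20 H2] := cy _ e2.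
exists (Num.min d1 d2); first by rewrite lt_min d10.
move=> s; rewrite lt_min => /andP[/H1 h1 /H2 h2].
by rewrite (le_lt_trans (nc_le_ReIm _))//= (splitr e) ltrD.
Qed.

Lemma kcont_real (x : R -> R) t : {for t, continuous x} -> kcont (fun s => (x s)%:C) t.
Proof. by move=> cx; apply: kcont_ReIm => //; exact: cvg_cst. Qed.
End paths.
End ComplexNorm.

(** * The complex exponential *)

Section ComplexExp.
Context {R : realType}.
Local Notation C := R[i].
Implicit Types (z w : C) (x y t r : R).

Definition cexp z : C := (expR (Re z) * cos (Im z)) +i* (expR (Re z) * sin (Im z)).

Lemma cexpD z w : cexp (z + w) = cexp z * cexp w.
Proof.
apply: cplx_ext; rewrite /= Re_add Im_add expRD ?cosD ?sinD; ring.
Qed.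

Lemma nc_cexp z : nc (cexp z) = expR (Re z).
Proof.
rewrite /= !exprMn -mulrDr cos2Dsin2 mulr1 sqrtr_sqr ger0_norm// expR_ge0.
Qed.

Lemma cexp0 : cexp 0 = 1.
Proof. by rewrite /cexp /= expR0 cos0 sin0 mulr1 mulr0. Qed.

Lemma real_approx (f : R -> R) x l : is_derive x 1 f l -> forall e, 0 < e ->
  exists2 d, 0 < d & forall y, `|y - x| < d ->
    `|f y - f x - l * (y - x)| <= e * `|y - x|.
Proof.
move=> df e e0; have [hf <-] := is_derive_holo df; have [d d0 Hd] := holo_approx hf e0.
by exists d.
Qed.

Lemma holo_cexp0 : holo cexp 0 /\ cder cexp (0 : C) = 1.
Proof.
apply: nc_holo => e e0.
(* The real and the imaginary part of the remainder are each at most [3 * (u * n)], hence the 6;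
   [u <= 1] controls the mixed terms. *)
pose u := Num.min (e / 6) 1.
have u0 : 0 < u by rewrite lt_min ltr01 divr_gt0.
have u1 : u <= 1 by rewrite ge_min lexx orbT.
have ue : 6 * u <= e by rewrite mulrC -ler_pdivlMr// ge_min lexx.
have [d1 d10 H1] := real_approx (is_derive_expR (0 : R)) u0.
have [d2 d20 H2] := real_approx (is_derive_cos (0 : R)) u0.
have [d3 d30 H3] := real_approx (is_derive_sin (0 : R)) u0.
exists (Num.min (Num.min d1 d2) (Num.min d3 (u / 2))).
  by rewrite !lt_min d10 d20 d30 divr_gt0.
case=> x y; rewrite subr0 !lt_min mul1r => /andP[/andP[h1 h2] /andP[h3 h4]].
set n := nc _ in h1 h2 h3 h4 *.
have xn : `|x| <= n by apply: (Re_le_nc (x +i* y)).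
have yn : `|y| <= n by apply: (Im_le_nc (x +i* y)).
move: H1 => /(_ x); rewrite subr0 expR0 mul1r => /(_ (le_lt_trans xn h1)) H1.
move: H2 => /(_ y); rewrite subr0 cos0 sin0 oppr0 mul0r subr0 => /(_ (le_lt_trans yn h2)) H2.
move: H3 => /(_ y); rewrite subr0 sin0 cos0 mul1r subr0 => /(_ (le_lt_trans yn h3)) H3.
have n0 : 0 <= n by apply: le_trans xn.
have ce : `|cos y| <= 1 by rewrite ler_norml cos_geN1 cos_le1.
have E : `|expR x - 1| <= u.
  have -> : expR x - 1 = (expR x - 1 - x) + x by ring.
  apply: (le_trans (ler_normD _ _)).
  have : u * `|x| <= 1 * `|x| by rewrite ler_wpM2r.
  lra.
have S : `|sin y| <= 2 * n.
  have -> : sin y = (sin y - y) + y by ring.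
  apply: (le_trans (ler_normD _ _)).
  have : u * `|y| <= 1 * `|y| by rewrite ler_wpM2r.
  lra.
have X1 : `|1 + x| <= 2.
  apply: (le_trans (ler_normD _ _)); rewrite normr1; lra.
have un (v : R) : `|v| <= n -> u * `|v| <= u * n by move=> ?; rewrite ler_wpM2l// ltW.
have A : `|expR x * cos y - 1 - x| <= 3 * (u * n).
  have -> : expR x * cos y - 1 - x = (expR x - 1 - x) * cos y + (1 + x) * (cos y - 1) by ring.
  apply: (le_trans (ler_normD _ _)); rewrite !normrM.
  have a1 : `|expR x - 1 - x| * `|cos y| <= u * n.
    rewrite -[leRHS]mulr1 ler_pM// (le_trans H1)// un//.
  have a2 : `|1 + x| * `|cos y - 1| <= 2 * (u * n).
    by rewrite ler_pM// (le_trans H2)// un.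
  lra.
have B : `|expR x * sin y - y| <= 3 * (u * n).
  have -> : expR x * sin y - y = (expR x - 1) * sin y + (sin y - y) by ring.
  apply: (le_trans (ler_normD _ _)); rewrite !normrM.
  have a1 : `|expR x - 1| * `|sin y| <= u * (2 * n) by rewrite ler_pM.
  have := un _ yn; lra.
have F := nc_le_ReIm (cexp (x +i* y) - cexp 0 - (x +i* y)).
rewrite cexp0 in F *; rewrite /= oppr0 addr0 in F *.
apply: (le_trans F); have : 6 * u * n <= e * n by rewrite ler_wpM2r.
lra.
Qed.

Lemma holo_cexp z : holo cexp z.
Proof.
have -> : cexp = (fun w => cexp z * cexp (w - z)).
  by apply/funext => w; rewrite -cexpD addrC subrK.
apply: holoM; first exact: holo_cst.
apply: (@holo_comp _ cexp (fun w => w - z)).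
  by apply: holoB; [exact: holo_id | exact: holo_cst].
by rewrite subrr; case: holo_cexp0.
Qed.

Definition circ r t : C := (r * cos t) +i* (r * sin t).

Lemma nc_circ r t : 0 <= r -> nc (circ r t) = r.
Proof. by move=> r0; rewrite /= !exprMn -mulrDr cos2Dsin2 mulr1 sqrtr_sqr ger0_norm. Qed.

Lemma circ_cexp r t : 0 < r -> circ r t = cexp (ln r +i* t).
Proof. by move=> r0; rewrite /cexp /= lnK. Qed.

Lemma kcont_circ r t : kcont (circ r) t.
Proof.
by apply: kcont_ReIm; apply: cvgM; first [exact: cvg_cst | exact: continuous_cos | exact: continuous_sin].
Qed.

Lemma circ0 t : circ 0 t = 0.
Proof. by rewrite /circ !mul0r. Qed.

Lemma nc_circB r s t : nc (circ r t - circ s t) = `|r - s|.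
Proof.
have -> : circ r t - circ s t = circ (r - s) t.
  by apply: cplx_ext => /=; rewrite mulrBl.
by rewrite /= !exprMn -mulrDr cos2Dsin2 mulr1 sqrtr_sqr.
Qed.
End ComplexExp.

(** * Integrals of complex-valued functions *)

Section ComplexIntegral.
Context {R : realType}.
Local Notation C := R[i].
Implicit Types (a b c m t : R) (x y : R -> R) (F G : R -> C).
Local Notation mu := (@lebesgue_measure R).

Definition RI a b x : R := \int[mu]_(t in `[a, b]) x t.

Definition cont_on a b x := forall t, a <= t <= b -> {for t, continuous x}.

Lemma RI_integrable a b x : cont_on a b x -> mu.-integrable `[a, b] (EFin \o x).
Proof.
move=> cx; apply: continuous_compact_integrable; first exact: segment_compact.
apply: continuous_in_subspaceT => t; rewrite inE /= in_itv /=; exact: cx.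
Qed.

Lemma cont_on_cst a b c : cont_on a b (fun=> c).
Proof. by move=> t _; exact: cvg_cst. Qed.

Lemma RI_ext a b x y : (forall t, a <= t <= b -> x t = y t) -> RI a b x = RI a b y.
Proof. by move=> H; apply: eq_Rintegral => t; rewrite inE /= in_itv /=; exact: H. Qed.

Lemma RID a b x y : cont_on a b x -> cont_on a b y ->
  RI a b (fun t => x t + y t) = RI a b x + RI a b y.
Proof. by move=> cx cy; apply: RintegralD => //; exact: RI_integrable. Qed.

Lemma RIZ a b c x : cont_on a b x -> RI a b (fun t => c * x t) = c * RI a b x.
Proof. by move=> cx; apply: RintegralZl => //; exact: RI_integrable. Qed.

Lemma RI_cst a b c : a <= b -> RI a b (fun=> c) = c * (b - a).
Proof.
move=> ab; rewrite /RI Rintegral_cst//= lebesgue_measure_itv /= lte_fin.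
have [ltab|ltba|<-] := ltgtP a b; rewrite ?subrr ?mulr0//=; by move: (le_lt_trans ab ltba); rewrite ltxx.
Qed.

Lemma le_RI a b x y : cont_on a b x -> cont_on a b y ->
  (forall t, a <= t <= b -> x t <= y t) -> RI a b x <= RI a b y.
Proof.
by move=> cx cy xy; apply: le_Rintegral => //; exact: RI_integrable.
Qed.

Lemma RI_split a m b x : a <= m -> m <= b -> cont_on a b x ->
  RI a b x = RI a m x + RI m b x.
Proof.
move=> am mb cx.
have int := RI_integrable cx.
have E := Rintegral_itvB int (x := m).
have {}E : RI a b x - RI a m x = \int[mu]_(t in `]m, b]) x t.
  by apply: E; rewrite !bnd_simp.
rewrite Rintegral_itv_obnd_cbnd in E; last first.
  by apply: integrableS int => //; apply: subset_itvr; rewrite bnd_simp.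
by rewrite addrC -[RI m b x]E subrK.
Qed.

Lemma RI_ge0 a b x : (forall t, a <= t <= b -> 0 <= x t) -> 0 <= RI a b x.
Proof. by move=> H; apply: Rintegral_ge0 => t; rewrite /= in_itv /=; exact: H. Qed.

Definition ccont_on a b F := forall t, a <= t <= b -> kcont F t.

Definition CI a b F : C := RI a b (fun t => Re (F t)) +i* RI a b (fun t => Im (F t)).

Lemma ccont_on_Re a b F : ccont_on a b F -> cont_on a b (fun t => Re (F t)).
Proof. by move=> cF t /cF; exact: kcont_Re. Qed.

Lemma ccont_on_Im a b F : ccont_on a b F -> cont_on a b (fun t => Im (F t)).
Proof. by move=> cF t /cF; exact: kcont_Im. Qed.

Lemma ccont_on_nc a b F : ccont_on a b F -> cont_on a b (fun t => nc (F t)).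
Proof. by move=> cF t /cF; exact: kcont_norm. Qed.

Lemma CI_ext a b F G : (forall t, a <= t <= b -> F t = G t) -> CI a b F = CI a b G.
Proof. by move=> H; congr (_ +i* _); apply: RI_ext => t /H ->. Qed.

Lemma CID a b F G : ccont_on a b F -> ccont_on a b G ->
  CI a b (fun t => F t + G t) = CI a b F + CI a b G.
Proof.
move=> cF cG; apply: cplx_ext => /=; rewrite -RID.
- by apply: RI_ext => t _; rewrite Re_add.
- exact: ccont_on_Re.
- exact: ccont_on_Re.
- by apply: RI_ext => t _; rewrite Im_add.
- exact: ccont_on_Im.
- exact: ccont_on_Im.
Qed.

Lemma CIZ a b c F : ccont_on a b F -> CI a b (fun t => c%:C * F t) = c%:C * CI a b F.
Proof.
move=> cF; apply: cplx_ext; rewrite ?Re_mul ?Im_mul /= !mul0r ?subr0 ?addr0 -RIZ.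
- by apply: RI_ext => t _; rewrite Re_mul /= mul0r subr0.
- exact: ccont_on_Re.
- by apply: RI_ext => t _; rewrite Im_mul /= mul0r addr0.
- exact: ccont_on_Im.
Qed.

Lemma CIi a b F : ccont_on a b F -> CI a b (fun t => 'i%C * F t) = 'i%C * CI a b F.
Proof.
move=> cF; apply: cplx_ext; rewrite ?Re_mul ?Im_mul /= !mul0r !mul1r ?sub0r ?add0r.
  rewrite -mulN1r -RIZ; last exact: ccont_on_Im.
  by apply: RI_ext => t _; rewrite Re_mul /= mul0r mul1r sub0r mulN1r.
by apply: RI_ext => t _; rewrite Im_mul /= mul0r mul1r add0r.
Qed.

Lemma ccont_on_cst a b (c : C) : ccont_on a b (fun=> c).
Proof. by move=> t _; exact: kcont_cst. Qed.

Lemma ccont_onZ a b F (c : C) : ccont_on a b F -> ccont_on a b (fun t => c * F t).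
Proof. by move=> cF t tab; apply: kcontM; [exact: kcont_cst|exact: cF]. Qed.

Lemma CIM a b (c : C) F : ccont_on a b F -> CI a b (fun t => c * F t) = c * CI a b F.
Proof.
move=> cF; rewrite [in RHS](complexE c) mulrDl -CIZ// -mulrA -CIZ// -CIi; last first.
  exact: ccont_onZ.
rewrite -CID.
- by apply: CI_ext => t _; rewrite [in LHS](complexE c) mulrDl mulrA.
- exact: ccont_onZ.
- by apply: ccont_onZ; exact: ccont_onZ.
Qed.

Lemma CIB a b F G : ccont_on a b F -> ccont_on a b G ->
  CI a b (fun t => F t - G t) = CI a b F - CI a b G.
Proof.
move=> cF cG.
transitivity (CI a b (fun t => F t + (-1) * G t)).
  by apply: CI_ext => t _; rewrite mulN1r.
by rewrite (CID cF (ccont_onZ (-1) cG)) (CIM _ cG) mulN1r.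
Qed.

Lemma CI_cst a b (c : C) : a <= b -> CI a b (fun=> c) = c * (b - a)%:C.
Proof.
move=> ab; apply: cplx_ext; rewrite ?Re_mul ?Im_mul /= RI_cst// mulr0 ?subr0 ?add0r//.
Qed.

Lemma CI_split a m b F : a <= m -> m <= b -> ccont_on a b F ->
  CI a b F = CI a m F + CI m b F.
Proof.
move=> am mb cF; apply: cplx_ext => /=; apply: RI_split => //.
  exact: ccont_on_Re.
exact: ccont_on_Im.
Qed.

Lemma CI_le_norm a b F : ccont_on a b F -> nc (CI a b F) <= RI a b (fun t => nc (F t)).
Proof.
move=> cF; have [->|I0] := eqVneq (CI a b F) 0.
  by rewrite nc0; apply: RI_ge0 => t _; exact: nc_ge0.
(* The unimodular factor [c] rotates the integral onto the positive axis, so that its modulus is the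
   integral of a real part. *)
set I := CI a b F in I0 *; pose c := (nc I)%:C / I.
have ncI : nc I != 0 by rewrite nc_eq0.
have c1 : nc c = 1.
  by rewrite ncM ncV nc_real ger0_norm ?nc_ge0// divff.
have E : nc I = Re (CI a b (fun t => c * F t)) by rewrite CIM// /c divfK.
rewrite [leLHS]E /=; apply: le_RI => //.
- by apply: ccont_on_Re; exact: ccont_onZ.
- exact: ccont_on_nc.
- by move=> t _; rewrite (le_trans (ler_norm _))// (le_trans (Re_le_nc _))// ncM c1 mul1r.
Qed.

Lemma CI_bound a b F (B : R) : a <= b -> ccont_on a b F ->
  (forall t, a <= t <= b -> nc (F t) <= B) -> nc (CI a b F) <= B * (b - a).
Proof.
move=> ab cF FB; rewrite (le_trans (CI_le_norm cF))// -RI_cst//.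
by apply: le_RI => //; [exact: ccont_on_nc|exact: cont_on_cst].
Qed.
End ComplexIntegral.

(** * Goursat's theorem *)

Section Bisection.
Context {R : realType}.
Implicit Types (x y w h p q d : R).

Lemma half_pow_small w d : 0 <= w -> 0 < d -> exists n, w / 2 ^+ n < d.
Proof.
move=> w0 d0; exists (Num.bound (w / d)).
have B : w / d < (Num.bound (w / d))%:R by rewrite archi_boundP// divr_ge0// ltW.
rewrite ltr_pdivrMr ?exprn_gt0// mulrC -ltr_pdivrMr//.
by rewrite (lt_trans B)// -natrX ltr_nat ltn_expl.
Qed.

Lemma nested_dyadic (u : nat -> R) w : 0 <= w ->
  (forall n, u n <= u n.+1 /\ u n.+1 + w / 2 ^+ n.+1 <= u n + w / 2 ^+ n) ->
  exists p, forall n, u n <= p <= u n + w / 2 ^+ n.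
Proof.
move=> w0 Hu.
have mono : {homo u : n m / (n <= m)%N >-> n <= m}.
  by apply: homo_leq (@le_refl _ _) (@le_trans _ _) _ => n; have [] := Hu n.
have mono' : {homo (fun n => u n + w / 2 ^+ n) : n m / (n <= m)%N >-> m <= n}.
  apply: (@homo_leq _ (fun n => u n + w / 2 ^+ n) (fun a b => b <= a)).
  - by move=> a; exact: le_refl.
  - by move=> b a c ab bc; exact: le_trans bc ab.
  - by move=> n; have [] := Hu n.
have pos n : 0 <= w / 2 ^+ n by rewrite divr_ge0// exprn_ge0.
have ub n m : u m <= u n + w / 2 ^+ n.
  case: (leqP m n) => mn; first by rewrite (le_trans (mono _ _ mn))// lerDl.
  by rewrite (le_trans _ (mono' _ _ (ltnW mn)))// lerDl.
exists (sup (range u)) => n; apply/andP; split.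
  apply: ub_le_sup; last by exists n.
  by exists (u 0%N + w / 2 ^+ 0) => _ [m _ <-].
by apply: ge_sup; [exists (u 0%N); exists 0%N | move=> _ [m _ <-]].
Qed.

(** Compactness in the form of subdivision: if [P] failed, a nested sequence of failing quarters
    would shrink to a point around which [P] holds. It serves Goursat's theorem, uniform estimates
    on segments and the finiteness of singular sets. *)
Lemma bisection (P : R -> R -> R -> R -> Prop) x0 y0 w0 h0 : 0 <= w0 -> 0 <= h0 ->
  (forall x y w h, P x y (w / 2) (h / 2) -> P (x + w / 2) y (w / 2) (h / 2) ->
     P x (y + h / 2) (w / 2) (h / 2) -> P (x + w / 2) (y + h / 2) (w / 2) (h / 2) ->
     P x y w h) ->
  (forall p q, x0 <= p <= x0 + w0 -> y0 <= q <= y0 + h0 ->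
    exists2 d, 0 < d & forall x y w h, x <= p <= x + w -> y <= q <= y + h ->
      0 <= w < d -> 0 <= h < d -> P x y w h) ->
  P x0 y0 w0 h0.
Proof.
move=> wp hp Hsplit Hloc; apply: contrapT => NP.
pose N n (v : R * R) := ~ P v.1 v.2 (w0 / 2 ^+ n) (h0 / 2 ^+ n).
have half (v : R) n : v / 2 ^+ n / 2 = v / 2 ^+ n.+1 by rewrite exprSr invfM mulrA.
have step n v : N n v -> exists v', N n.+1 v' /\
  (v'.1 = v.1 \/ v'.1 = v.1 + w0 / 2 ^+ n.+1) /\ (v'.2 = v.2 \/ v'.2 = v.2 + h0 / 2 ^+ n.+1).
  rewrite /N => Nv; apply: contrapT => Hno; apply: Nv; apply: Hsplit; rewrite !half.
  - by apply: contrapT => K; apply: Hno; exists (v.1, v.2); split => //=; split; left.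
  - by apply: contrapT => K; apply: Hno; exists (v.1 + w0 / 2 ^+ n.+1, v.2); split => //=; split; [right|left].
  - by apply: contrapT => K; apply: Hno; exists (v.1, v.2 + h0 / 2 ^+ n.+1); split => //=; split; [left|right].
  - by apply: contrapT => K; apply: Hno; exists (v.1 + w0 / 2 ^+ n.+1, v.2 + h0 / 2 ^+ n.+1); split => //=; split; right.
(* Each corner is bundled with the failure of [P] on its rectangle, so that the recursion can choose
   the next failing quarter. *)
pose T n := {v | N n v}.
have next n (v : T n) : {v' : T n.+1 |
  (((sval v').1 = (sval v).1 \/ (sval v').1 = (sval v).1 + w0 / 2 ^+ n.+1) /\ ((sval v').2 = (sval v).2 \/ (sval v').2 = (sval v).2 + h0 / 2 ^+ n.+1))}.
  by case: v => v Nv; have /cid[v' [Nv' K]] := step n v Nv; exists (exist _ v' Nv').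
have N0 : N 0%N (x0, y0) by rewrite /N /= expr0 !divr1.
pose fix s n : T n := if n is m.+1 then sval (next m (s m)) else exist _ (x0, y0) N0.
pose u n := (sval (s n)).1; pose v n := (sval (s n)).2.
have un n : u n.+1 = u n \/ u n.+1 = u n + w0 / 2 ^+ n.+1 by have [] := svalP (next n (s n)).
have vn n : v n.+1 = v n \/ v n.+1 = v n + h0 / 2 ^+ n.+1 by have [] := svalP (next n (s n)).
have pos (c : R) n : 0 <= c -> 0 <= c / 2 ^+ n by move=> ?; rewrite divr_ge0// exprn_ge0.
have dbl (c : R) n : c / 2 ^+ n = c / 2 ^+ n.+1 + c / 2 ^+ n.+1 by rewrite -half -splitr.
have [|p Hp] := @nested_dyadic u w0 wp.
  move=> n; have := pos _ n.+1 wp; have := dbl w0 n.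
  by case: (un n) => -> ; lra.
have [|q Hq] := @nested_dyadic v h0 hp.
  move=> n; have := pos _ n.+1 hp; have := dbl h0 n.
  by case: (vn n) => -> ; lra.
have Hp0 := Hp 0%N; have Hq0 := Hq 0%N; rewrite expr0 !divr1 in Hp0 Hq0.
have [d d0 Hd] := Hloc p q Hp0 Hq0.
have [n hn] := half_pow_small (addr_ge0 wp hp) d0.
rewrite mulrDl in hn.
have wn := pos _ n wp; have hn' := pos _ n hp.
apply: (svalP (s n)); apply: Hd; [exact: Hp|exact: Hq| |]; lra.
Qed.
End Bisection.

(** * Contour integrals over rectangles *)

Section Goursat.
Context {R : realType}.
Local Notation C := R[i].
Variable G : C -> C.
Implicit Types (x y w h p q d : R).

Definition hint x w y := CI x (x + w) (fun t => G (t +i* y)).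
Definition vint y h x := CI y (y + h) (fun t => G (x +i* t)).
(** The integral of [G(z) dz] along the boundary of the rectangle, counterclockwise. *)
Definition rect_int x y w h : C :=
  hint x w y - hint x w (y + h) + 'i%C * (vint y h (x + w) - vint y h x).

Definition holo_rect x y w h := forall p q, x <= p <= x + w -> y <= q <= y + h ->
  holo G (p +i* q).

Lemma holo_kcont (F : R -> C) t : kcont F t -> holo G (F t) -> kcont (fun s => G (F s)) t.
Proof. by move=> cF hG; apply: kcont_comp => //; exact: holo_ccont. Qed.

Lemma kcont_h y t : kcont (fun t => t +i* y : C) t.
Proof. apply: kcont_ReIm; [exact: cvg_id|exact: cvg_cst]. Qed.

Lemma kcont_v x t : kcont (fun t => x +i* t : C) t.
Proof. apply: kcont_ReIm; [exact: cvg_cst|exact: cvg_id]. Qed.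

Lemma ccont_h x y w h q : holo_rect x y w h -> y <= q <= y + h ->
  ccont_on x (x + w) (fun t => G (t +i* q)).
Proof. by move=> H yq t xt; apply: holo_kcont; [exact: kcont_h|exact: H]. Qed.

Lemma ccont_v x y w h p : holo_rect x y w h -> x <= p <= x + w ->
  ccont_on y (y + h) (fun t => G (p +i* t)).
Proof. by move=> H yq t xt; apply: holo_kcont; [exact: kcont_v|exact: H]. Qed.

Lemma rect_int_split x y w h : 0 <= w -> 0 <= h -> holo_rect x y w h ->
  rect_int x y w h = rect_int x y (w / 2) (h / 2) + rect_int (x + w / 2) y (w / 2) (h / 2)
   + rect_int x (y + h / 2) (w / 2) (h / 2) + rect_int (x + w / 2) (y + h / 2) (w / 2) (h / 2).
Proof.
move=> w0 h0 H.
have Eh q : y <= q <= y + h -> hint x w q = hint x (w / 2) q + hint (x + w / 2) (w / 2) q.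
  move=> yq; rewrite /hint -addrA -splitr; apply: CI_split; [lra|lra|].
  exact: ccont_h H yq.
have Ev p : x <= p <= x + w -> vint y h p = vint y (h / 2) p + vint (y + h / 2) (h / 2) p.
  move=> yq; rewrite /vint -addrA -splitr; apply: CI_split; [lra|lra|].
  exact: ccont_v H yq.
rewrite /rect_int !Eh ?Ev; [|lra..].
rewrite -!addrA -!splitr; set i := 'i%C; ring.
Qed.

(** Opposite sides are paired. The affine part of [G] contributes [- 'i * h * g * w] to the
    horizontal pair and the opposite amount to the vertical one, so only the remainder, at most
    [e * (w + h)] at each boundary point, survives. *)
Lemma rect_int_local x y w h p q e d : 0 <= w -> 0 <= h -> 0 < e ->
  x <= p <= x + w -> y <= q <= y + h -> holo_rect x y w h -> w + h < d ->
  (forall z, nc (z - (p +i* q)) < d ->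
    nc (G z - G (p +i* q) - cder G (p +i* q) * (z - (p +i* q))) <= e * nc (z - (p +i* q))) ->
  nc (rect_int x y w h) <= 2 * e * (w + h) ^+ 2.
Proof.
move=> w0 h0 e0 xp yq H wh Hd; set z0 := p +i* q in Hd *; set g := cder _ _ in Hd.
have near (a b : R) : x <= a <= x + w -> y <= b <= y + h ->
  nc (G (a +i* b) - G z0 - g * (a +i* b - z0)) <= e * (w + h).
  move=> xa yb.
  have nz : nc (a +i* b - z0) <= w + h.
    rewrite (le_trans (nc_le_ReIm _))//= lerD// ler_norml; lra.
  by rewrite (le_trans (Hd _ _)) ?(le_lt_trans nz)// ler_wpM2l// ltW.
have A : nc (hint x w y - hint x w (y + h) + 'i%C * h%:C * g * w%:C) <= 2 * e * (w + h) * w.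
  have c1 : ccont_on x (x + w) (fun t => G (t +i* y)) by apply: ccont_h H _; lra.
  have c2 : ccont_on x (x + w) (fun t => G (t +i* (y + h))) by apply: ccont_h H _; lra.
  have c3 : ccont_on x (x + w) (fun t => G (t +i* y) - G (t +i* (y + h))).
    by move=> t xt; apply: kcontB; [exact: c1|exact: c2].
  have c4 : ccont_on x (x + w) (fun t : R => 'i%C * h%:C * g) by exact: ccont_on_cst.
  have xw : x <= x + w by lra.
  have <- : CI x (x + w) (fun t => G (t +i* y) - G (t +i* (y + h)) + 'i%C * h%:C * g) =
      hint x w y - hint x w (y + h) + 'i%C * h%:C * g * w%:C.
    rewrite (CID c3 c4) (CIB c1 c2) (CI_cst _ xw).
    by have -> : x + w - x = w by ring.
  have -> : 2 * e * (w + h) * w = 2 * e * (w + h) * (x + w - x) by ring.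
  apply: (CI_bound xw) => [t xt|t xt].
    by apply: kcontD; [exact: c3|exact: c4].
  have n1 := near t y xt; have n2 := near t (y + h) xt.
  have -> : G (t +i* y) - G (t +i* (y + h)) + 'i%C * h%:C * g =
     (G (t +i* y) - G z0 - g * (t +i* y - z0)) - (G (t +i* (y + h)) - G z0 - g * (t +i* (y + h) - z0)).
    have -> : t +i* (y + h) = t +i* y + 'i%C * h%:C by apply: cplx_ext; rewrite /=; ring.
    set i := 'i%C; ring.
  apply: (le_trans (ncB _ _)); have -> : 2 * e * (w + h) = e * (w + h) + e * (w + h) by ring.
  by rewrite lerD// ?n1 ?n2//; lra.
have B : nc (vint y h (x + w) - vint y h x - w%:C * g * h%:C) <= 2 * e * (w + h) * h.
  have c1 : ccont_on y (y + h) (fun t => G ((x + w) +i* t)) by apply: ccont_v H _; lra.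
  have c2 : ccont_on y (y + h) (fun t => G (x +i* t)) by apply: ccont_v H _; lra.
  have c3 : ccont_on y (y + h) (fun t => G ((x + w) +i* t) - G (x +i* t)).
    by move=> t xt; apply: kcontB; [exact: c1|exact: c2].
  have c4 : ccont_on y (y + h) (fun t : R => w%:C * g) by exact: ccont_on_cst.
  have yh : y <= y + h by lra.
  have <- : CI y (y + h) (fun t => G ((x + w) +i* t) - G (x +i* t) - w%:C * g) =
      vint y h (x + w) - vint y h x - w%:C * g * h%:C.
    rewrite (CIB c3 c4) (CIB c1 c2) (CI_cst _ yh).
    by have -> : y + h - y = h by ring.
  have -> : 2 * e * (w + h) * h = 2 * e * (w + h) * (y + h - y) by ring.
  apply: (CI_bound yh) => [t xt|t xt].
    by apply: kcontB; [exact: c3|exact: c4].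
  have n1 := near (x + w) t _ xt; have n2 := near x t _ xt.
  have -> : G ((x + w) +i* t) - G (x +i* t) - w%:C * g =
     (G ((x + w) +i* t) - G z0 - g * ((x + w) +i* t - z0)) - (G (x +i* t) - G z0 - g * (x +i* t - z0)).
    have -> : (x + w) +i* t = x +i* t + w%:C by apply: cplx_ext; rewrite /=; ring.
    ring.
  apply: (le_trans (ncB _ _)); have -> : 2 * e * (w + h) = e * (w + h) + e * (w + h) by ring.
  by rewrite lerD// ?n1 ?n2//; lra.
have -> : rect_int x y w h = (hint x w y - hint x w (y + h) + 'i%C * h%:C * g * w%:C)
   + 'i%C * (vint y h (x + w) - vint y h x - w%:C * g * h%:C).
  by rewrite /rect_int; set i := 'i%C; ring.
apply: (le_trans (ncD _ _)); rewrite ncM.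
have -> : nc 'i%C = 1 :> R by rewrite /= expr0n expr1n add0r sqrtr1.
have -> : 2 * e * (w + h) ^+ 2 = 2 * e * (w + h) * w + 2 * e * (w + h) * h by ring.
by rewrite mul1r lerD.
Qed.

Lemma half_sub x w : 0 <= w -> [/\ x + w / 2 <= x + w, x <= x + w / 2 & x + w / 2 + w / 2 <= x + w].
Proof. by move=> w0; split; lra. Qed.

Lemma holo_rect_sub x y w h a b : holo_rect x y w h ->
  x <= a -> a + w / 2 <= x + w -> y <= b -> b + h / 2 <= y + h ->
  holo_rect a b (w / 2) (h / 2).
Proof.
move=> H xa aw yb bh p q /andP[ap pa] /andP[bq qb]; apply: H; apply/andP; split.
- exact: le_trans ap.
- exact: le_trans pa aw.
- exact: le_trans bq.
- exact: le_trans qb bh.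
Qed.

(** Halving both sides divides [(w + h) ^+ 2] by 4, so the local bound is additive over the four
    quarters and [bisection] extends it to the whole rectangle, for every [e']. *)
Lemma goursat x y w h : 0 <= w -> 0 <= h -> holo_rect x y w h -> rect_int x y w h = 0.
Proof.
move=> w0 h0 H.
suff K e : 0 < e -> nc (rect_int x y w h) <= e.
  apply/eqP; rewrite -nc_eq0; apply/eqP/le_anti; rewrite nc_ge0 andbT.
  by apply/ler_addgt0Pl => e /K; rewrite addr0.
move=> e0.
(* The summand 1 keeps the denominator positive for a degenerate rectangle. *)
pose e' := e / (2 * ((w + h) ^+ 2 + 1)).
have q0 : 0 < (w + h) ^+ 2 + 1 by rewrite ltr_wpDl// sqr_ge0.
have e'0 : 0 < e' by rewrite divr_gt0// mulr_gt0.
have Ee' : 2 * e' * ((w + h) ^+ 2 + 1) = e by rewrite /e'; field; rewrite gt_eqF.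
suff : 0 <= w -> 0 <= h -> holo_rect x y w h -> nc (rect_int x y w h) <= 2 * e' * (w + h) ^+ 2.
  move=> /(_ w0 h0 H) /le_trans; apply; rewrite -[leRHS]Ee' ler_wpM2l ?lerDl//.
  by rewrite mulr_ge0// ltW.
apply: (@bisection R (fun x y w h => 0 <= w -> 0 <= h -> holo_rect x y w h -> nc (rect_int x y w h) <= 2 * e' * (w + h) ^+ 2)) => //.
  clear Ee' q0; clearbody e'.
  move=> {H w0 h0}{}x {}y {}w {}h H1 H2 H3 H4 w0 h0 H.
  have w2 : 0 <= w / 2 by rewrite divr_ge0.
  have h2 : 0 <= h / 2 by rewrite divr_ge0.
  rewrite rect_int_split//.
  have [x1 x2 x3] := half_sub x w0; have [y1 y2 y3] := half_sub y h0.
  have {}H1 := H1 w2 h2 (holo_rect_sub H (lexx x) x1 (lexx y) y1).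
  have {}H2 := H2 w2 h2 (holo_rect_sub H x2 x3 (lexx y) y1).
  have {}H3 := H3 w2 h2 (holo_rect_sub H (lexx x) x1 y2 y3).
  have {}H4 := H4 w2 h2 (holo_rect_sub H x2 x3 y2 y3).
  apply: (le_trans (ncD _ _)); apply: (le_trans (lerD (le_trans (ncD _ _) (lerD (ncD _ _) (lexx _))) (lexx _))).
  have -> : 2 * e' * (w + h) ^+ 2 = 2 * e' * (w / 2 + h / 2) ^+ 2 + 2 * e' * (w / 2 + h / 2) ^+ 2 + 2 * e' * (w / 2 + h / 2) ^+ 2 + 2 * e' * (w / 2 + h / 2) ^+ 2.
    by field.
  by apply: lerD H4; apply: lerD H3; exact: lerD H1 H2.
move=> p q xp yq; have [d d0 Hd] := holo_nc (H p q xp yq) e'0.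
exists (d / 2); first by rewrite divr_gt0.
move=> x' y' w' h' xp' yq' /andP[w'0 wd] /andP[h'0 hd] _ _ H'.
apply: (rect_int_local (d := d) w'0 h'0 e'0 xp' yq' H') => //; lra.
Qed.
End Goursat.

(** * Circle means *)

Section Mean.
Context {R : realType}.
Local Notation C := R[i].
Implicit Types (x y : R -> R) (F G : R -> C) (r s t : R) (f g : C -> C) (z w : C).

Let pi2 : 0 < 2 * pi :> R. Proof. by rewrite mulr_gt0// pi_gt0. Qed.

Let pi2' : 0 <= 2 * pi :> R. Proof. exact: ltW. Qed.

Definition rmean x : R := (2 * pi)^-1 * RI 0 (2 * pi) x.
Definition mean F : C := ((2 * pi)^-1)%:C * CI 0 (2 * pi) F.

Lemma Re_mean F : Re (mean F) = rmean (fun t => Re (F t)).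
Proof. by rewrite /mean Re_mul /= mul0r subr0. Qed.

Lemma rmean_ext x y : x =1 y -> rmean x = rmean y.
Proof. by move=> /funext ->. Qed.

Lemma le_rmean x y : continuous x -> continuous y -> (forall t, x t <= y t) ->
  rmean x <= rmean y.
Proof.
move=> cx cy xy; apply: ler_wpM2l; first by rewrite invr_ge0.
by apply: le_RI => [t _|t _|t _]; [exact: cx|exact: cy|].
Qed.

Lemma le_rmean_on x y : continuous x -> continuous y ->
  (forall t, 0 <= t <= 2 * pi -> x t <= y t) -> rmean x <= rmean y.
Proof.
move=> cx cy xy; apply: ler_wpM2l; first by rewrite invr_ge0.
by apply: le_RI => [t _|t _|t tp]; [exact: cx|exact: cy|exact: xy].
Qed.

Lemma rmeanD x y : continuous x -> continuous y ->
  rmean (fun t => x t + y t) = rmean x + rmean y.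
Proof.
move=> cx cy; rewrite /rmean RID ?mulrDr// => t _; [exact: cx|exact: cy].
Qed.

Lemma rmeanZ c x : continuous x -> rmean (fun t => c * x t) = c * rmean x.
Proof. by move=> cx; rewrite /rmean RIZ 1?mulrCA// => t _; exact: cx. Qed.

Lemma rmean_cst c : rmean (fun=> c) = c.
Proof. by rewrite /rmean RI_cst// subr0 mulrC mulfK// gt_eqF. Qed.

Lemma rmean_ge0 x : (forall t, 0 <= x t) -> 0 <= rmean x.
Proof. by move=> x0; rewrite mulr_ge0 ?invr_ge0// RI_ge0. Qed.

Definition kcontinuous F := forall t, kcont F t.

Lemma kcontinuousM F G : kcontinuous F -> kcontinuous G -> kcontinuous (fun t => F t * G t).
Proof. by move=> cF cG t; apply: kcontM; [exact: cF|exact: cG]. Qed.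

Lemma kcontinuousB F G : kcontinuous F -> kcontinuous G -> kcontinuous (fun t => F t - G t).
Proof. by move=> cF cG t; apply: kcontB; [exact: cF|exact: cG]. Qed.

Lemma kcontinuousZ (c : C) F : kcontinuous F -> kcontinuous (fun t => c * F t).
Proof. by move=> cF t; apply: kcontM; [exact: kcont_cst|exact: cF]. Qed.

Lemma kcontinuousV F : (forall t, F t != 0) -> kcontinuous F -> kcontinuous (fun t => (F t)^-1).
Proof. by move=> F0 cF t; apply: kcontV; [exact: F0|exact: cF]. Qed.

Lemma kcontinuous_cst (c : C) : kcontinuous (fun=> c).
Proof. by move=> t; exact: kcont_cst. Qed.

Lemma kcontinuous_circ r : kcontinuous (circ r).
Proof. by move=> t; exact: kcont_circ. Qed.

Lemma kcontinuous_nc F : kcontinuous F -> continuous (fun t => nc (F t)).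
Proof. by move=> cF t; exact: kcont_norm. Qed.

Lemma kcontinuous_Re F : kcontinuous F -> continuous (fun t => Re (F t)).
Proof. by move=> cF t; exact: kcont_Re. Qed.

Lemma mean_ext F G : F =1 G -> mean F = mean G.
Proof. by move=> /funext ->. Qed.

Let on F : kcontinuous F -> ccont_on 0 (2 * pi) F.
Proof. by move=> cF t _; exact: cF. Qed.

Lemma meanB F G : kcontinuous F -> kcontinuous G ->
  mean (fun t => F t - G t) = mean F - mean G.
Proof. by move=> cF cG; rewrite /mean (CIB (on cF) (on cG)) mulrBr. Qed.

Lemma meanM (c : C) F : kcontinuous F -> mean (fun t => c * F t) = c * mean F.
Proof. by move=> cF; rewrite /mean (CIM c (on cF)) mulrCA. Qed.

Lemma mean_cst (c : C) : mean (fun=> c) = c.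
Proof.
by rewrite /mean CI_cst// subr0 mulrC -mulrA -rmorphM/= divff ?mulr1// gt_eqF.
Qed.

Lemma mean_norm F : kcontinuous F -> nc (mean F) <= rmean (fun t => nc (F t)).
Proof.
move=> cF; rewrite ncM nc_real ger0_norm ?invr_ge0// ler_wpM2l ?invr_ge0//.
exact: CI_le_norm (on cF).
Qed.

Lemma mean_bound F (B : R) : kcontinuous F -> (forall t, nc (F t) <= B) -> nc (mean F) <= B.
Proof.
move=> cF FB; rewrite (le_trans (mean_norm cF))// -[leRHS]rmean_cst.
by apply: le_rmean => // t; [exact: kcontinuous_nc|exact: cvg_cst].
Qed.

Lemma mean_bound_on F (B : R) : kcontinuous F ->
  (forall t, 0 <= t <= 2 * pi -> nc (F t) <= B) -> nc (mean F) <= B.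
Proof.
move=> cF FB; rewrite (le_trans (mean_norm cF))// -[leRHS]rmean_cst.
by apply: le_rmean_on => // t; [exact: kcontinuous_nc|exact: cvg_cst].
Qed.

Definition cmean g r := mean (fun t => g (circ r t)).

Lemma kcontinuous_circle g r : (forall z, nc z = r -> ccont g z) -> 0 <= r ->
  kcontinuous (fun t => g (circ r t)).
Proof. by move=> H r0 t; apply: kcont_comp (kcont_circ r t) _; apply: H; rewrite nc_circ. Qed.

(* [g \o cexp] has period [2 pi i], so the horizontal sides of the rectangle
   [[ln r, ln s] x [0, 2 pi]] cancel in Goursat's theorem. *)
Lemma cmean_annulus g r s : 0 < r -> r <= s ->
  (forall z, r <= nc z <= s -> holo g z) -> cmean g r = cmean g s.
Proof.
move=> r0 rs H; have s0 : 0 < s by exact: lt_le_trans rs.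
pose G w := g (cexp w).
have ls : ln r <= ln s by rewrite ler_ln.
have HG : holo_rect G (ln r) 0 (ln s - ln r) (2 * pi).
  move=> p q /andP[rp ps] _; apply: holo_comp; first exact: holo_cexp.
  apply: H; rewrite nc_cexp /=; apply/andP; split.
    by rewrite -[leLHS]lnK// ler_expR.
  by rewrite -[leRHS]lnK// ler_expR; rewrite addrC subrK in ps.
have := goursat _ pi2' HG; rewrite subr_ge0 => /(_ ls).
rewrite /rect_int add0r.
have -> : hint G (ln r) (ln s - ln r) (2 * pi) = hint G (ln r) (ln s - ln r) 0.
  by apply: CI_ext => t _; rewrite /G /cexp /= mulr_natl cos2pi sin2pi cos0 sin0.
rewrite subrr add0r => /eqP; rewrite mulf_eq0 => /orP[/eqP[] /eqP|].
  by rewrite oner_eq0.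
have vE u : 0 < u -> vint G 0 (2 * pi) (ln u) = CI 0 (2 * pi) (fun t => g (circ u t)).
  by move=> u0; rewrite /vint add0r; apply: CI_ext => t _; rewrite circ_cexp.
rewrite (addrC (ln r)) subrK !vE// subr_eq0 => /eqP E.
by rewrite /cmean /mean E.
Qed.

(** [bisection] is applied to a rectangle of height 0. The smaller of the constants of two halves
    serves both, because [Q] is inherited by smaller [d]. *)
Lemma compact_unif a b (Q : R -> R -> Prop) : a <= b ->
  (forall t d d', d' <= d -> Q t d -> Q t d') ->
  (forall p, a <= p <= b -> exists2 d, 0 < d & forall t, a <= t <= b -> `|t - p| < d -> Q t d) ->
  exists2 d, 0 < d & forall t, a <= t <= b -> Q t d.
Proof.
move=> ab anti loc.
have := @bisection R (fun x y w h : R => exists2 d, 0 < d & forall t, a <= t <= b -> x <= t <= x + w -> Q t d) a 0 (b - a) 0.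
case.
- by rewrite subr_ge0.
- by [].
- move=> x y w h [d1 d10 H1] [d2 d20 H2] _ _.
  exists (Num.min d1 d2); first by rewrite lt_min d10.
  move=> t tab /andP[xt tx]; have [tw|wt] := leP t (x + w / 2).
    by apply: (anti _ d1); [rewrite ge_min lexx | apply: H1; rewrite ?xt].
  apply: (anti _ d2); first by rewrite ge_min lexx orbT.
  by apply: H2 => //; rewrite (ltW wt) -addrA -splitr.
- move=> p q; rewrite addrC subrK => pab _; have [d d0 Hd] := loc p pab.
  exists d => // x y w h /andP[xp px] _ /andP[w0 wd] _; exists d => // t tab /andP[xt tx].
  apply: Hd => //; rewrite ltr_norml; apply/andP; split; lra.
- by move=> d d0 Hd; exists d => // t tab; apply: Hd => //; rewrite addrC subrK.
Qed.

(** Goursat's theorem on annuli reaches neither the radius 0 nor the radius of an exceptional point;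
    continuity in the radius bridges both. *)
Lemma cmean_cont g r : 0 <= r -> (forall z, nc z = r -> ccont g z) ->
  forall e, 0 < e -> exists2 d, 0 < d & forall s, 0 <= s -> `|s - r| < d ->
    (forall z, nc z = s -> ccont g z) -> nc (cmean g s - cmean g r) <= e.
Proof.
move=> r0 cg e e0.
have [||d d0 Hd] := @compact_unif 0 (2 * pi)
  (fun t d => forall s, `|s - r| < d -> nc (g (circ s t) - g (circ r t)) <= e) pi2'.
- by move=> t d d' dd H s sr; apply: H; exact: lt_le_trans dd.
- move=> p _.
  have e2 : 0 < e / 2 by rewrite divr_gt0.
  have [d d0 Hd] := ccont_nc (cg _ (nc_circ p r0)) e2.
  (* One half of [d] pays for the radial move from [r] to [s], the other for the move from [p] to
     [t] along the circle. *)
  have d2 : 0 < d / 2 by rewrite divr_gt0.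
  have [d' d'0 Hd'] := (kcont_nc _ _).1 (kcont_circ r p) _ d2.
  exists (Num.min d' (d / 2)); first by rewrite lt_min d'0.
  move=> t _; rewrite lt_min => /andP[td' _] s; rewrite lt_min => /andP[_ sd].
  have -> : g (circ s t) - g (circ r t) =
    (g (circ s t) - g (circ r p)) - (g (circ r t) - g (circ r p)) by ring.
  have A := Hd' t td'.
  apply: (le_trans (ncB _ _)); rewrite [leRHS]splitr lerD// ltW// Hd//.
    have -> : circ s t - circ r p = (circ s t - circ r t) + (circ r t - circ r p) by ring.
    by rewrite (le_lt_trans (ncD _ _))// (splitr d) ltrD// nc_circB.
  by rewrite (lt_trans A)// ltr_pdivrMr// ltr_pMr// ltr1n.
exists d => // s s0 sd cs.
have c1 := kcontinuous_circle cs s0; have c2 := kcontinuous_circle cg r0.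
have step t : 0 <= t <= 2 * pi -> nc (g (circ s t) - g (circ r t)) <= e.
  by move=> tp; exact: Hd.
rewrite -(meanB c1 c2) /mean ncM nc_real ger0_norm ?invr_ge0//.
rewrite mulrC ler_pdivrMr//; have -> : e * (2 * pi) = e * (2 * pi - 0) by rewrite subr0.
by apply: CI_bound => //; apply: on; exact: kcontinuousB.
Qed.

Lemma nc_le_eps_eq0 z : (forall e, 0 < e -> nc z <= e) -> z = 0.
Proof.
move=> H; apply/eqP; rewrite -nc_eq0; apply/eqP/le_anti; rewrite nc_ge0 andbT.
by apply/ler_addgt0Pl => e /H; rewrite addr0.
Qed.

Lemma cmean_0 g : cmean g 0 = g 0.
Proof. by rewrite /cmean -[RHS]mean_cst; apply: mean_ext => t; rewrite circ0. Qed.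

(* The exceptional point [p] makes this applicable to difference quotients at [p]. *)
Lemma mean_value g (p : C) rho r : 0 <= r < rho -> ccont g p -> nc p < rho ->
  (forall z, nc z < rho -> z != p -> holo g z) -> cmean g r = g 0.
Proof.
move=> /andP[r0 rr] gp prho H.
have cg z : nc z < rho -> ccont g z.
  by move=> zr; have [->//|zp] := eqVneq z p; apply: holo_ccont; exact: H.
(* Annuli that avoid [p] make the mean constant on the radii below [nc p] and on those above it.
   Continuity in the radius then joins the two ranges and attaches the radius 0. *)
have ann s s' : 0 < s -> s <= s' -> s' < rho -> (nc p < s \/ s' < nc p) -> cmean g s = cmean g s'.
  move=> s0 ss' s'r ps; apply: cmean_annulus => // z /andP[z1 z2].
  apply: H; first exact: le_lt_trans s'r.
  by apply: contraPneq ps => <-; case; rewrite ltNge ?z1 ?z2.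
have near s : 0 <= s < rho -> forall e, 0 < e -> exists2 d, 0 < d &
    forall s', 0 <= s' < rho -> `|s' - s| < d -> nc (cmean g s' - cmean g s) <= e.
  move=> /andP[s0 sr] e e0.
  have [|d d0 Hd] := cmean_cont s0 _ e0 (g := g); first by move=> z zs; apply: cg; rewrite zs.
  by exists d => // s' /andP[s'0 s'r] s's; apply: Hd => // z zs'; apply: cg; rewrite zs'.
have above s : nc p < s -> s < rho -> cmean g s = cmean g (nc p).
  move=> ps sr; apply/eqP; rewrite -subr_eq0; apply/eqP/nc_le_eps_eq0 => e e0.
  have [|d d0 Hd] := near (nc p) _ _ e0; first by rewrite nc_ge0.
  pose s' := Num.min s (nc p + d / 2).
  have ps' : nc p < s' by rewrite lt_min ps ltrDl divr_gt0.
  have s's : s' <= s by rewrite ge_min lexx.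
  have s'0 : 0 < s' := le_lt_trans (nc_ge0 _) ps'.
  rewrite -(ann s' s)//; last by left.
  apply: Hd; first by rewrite ltW//= (le_lt_trans s's).
  rewrite gtr0_norm ?subr_gt0// ltrBlDl (@le_lt_trans _ _ (nc p + d / 2))//.
    by rewrite ge_min lexx orbT.
  by rewrite ltrD2l ltr_pdivrMr// ltr_pMr// ltr1n.
have below s : 0 <= s -> s < nc p -> cmean g s = cmean g 0.
  rewrite le_eqVlt => /predU1P[<-//|s0 sp]; apply/eqP; rewrite -subr_eq0; apply/eqP/nc_le_eps_eq0 => e e0.
  have r1 : 0 < rho := le_lt_trans (nc_ge0 _) prho.
  have [|d d0 Hd] := near 0 _ _ e0; first by rewrite lexx.
  pose s' := Num.min s (d / 2).
  have ps' : 0 < s' by rewrite lt_min s0 divr_gt0.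
  have s's : s' <= s by rewrite ge_min lexx.
  rewrite -(ann s' s)//; [|exact: lt_trans sp prho|by right].
  apply: Hd; first by rewrite ltW//= (le_lt_trans s's)// (lt_trans sp).
  rewrite subr0 gtr0_norm// (@le_lt_trans _ _ (d / 2))// ?ge_min ?lexx ?orbT//.
  by rewrite ltr_pdivrMr// ltr_pMr// ltr1n.
have at_p : cmean g (nc p) = cmean g 0.
  have [->//|p0] := eqVneq (nc p) 0.
  have {}p0 : 0 < nc p by rewrite lt0r p0 nc_ge0.
  apply/eqP; rewrite -subr_eq0; apply/eqP/nc_le_eps_eq0 => e e0.
  have [|d d0 Hd] := near (nc p) _ _ e0; first by rewrite nc_ge0.
  pose s' := Num.max (nc p / 2) (nc p - d / 2).
  have s'0 : 0 <= s' by rewrite le_max divr_ge0// nc_ge0.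
  have d20 : 0 < d / 2 by rewrite divr_gt0.
  have s'p : s' < nc p by rewrite gt_max gtrBl d20 andbT ltr_pdivrMr// ltr_pMr// ltr1n.
  rewrite -(below s')// nc_distC; apply: Hd; first by rewrite s'0 (lt_trans s'p).
  rewrite ltr0_norm ?subr_lt0// opprB ltrBlDr -ltrBlDl (@lt_le_trans _ _ (nc p - d / 2))//.
    by rewrite ler_ltD// ltrN2 ltr_pdivrMr// ltr_pMr// ltr1n.
  by rewrite le_max lexx orbT.
rewrite -cmean_0; have [rp|pr|->] := ltgtP r (nc p).
- exact: below.
- by rewrite above.
- exact: at_p.
Qed.
End Mean.

(** * Cauchy's formula *)

Section Cauchy.
Context {R : realType}.
Local Notation C := R[i].
Implicit Types (F : R -> C) (r s t B rho : R) (f g : C -> C) (z w p : C).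

Definition holo_disc f rho := forall z, nc z < rho -> holo f z.

Lemma disc_neq z w : nc w < nc z -> z - w != 0.
Proof. by rewrite subr_eq0; apply: contraTneq => ->; rewrite ltxx. Qed.

Lemma circ_neq r t w : nc w < r -> circ r t - w != 0.
Proof. by move=> wr; apply: disc_neq; rewrite nc_circ// (le_trans (nc_ge0 w))// ltW. Qed.

Lemma kcontinuous_kernel r w : nc w < r ->
  kcontinuous (fun t => circ r t / (circ r t - w)).
Proof.
move=> wr; apply: kcontinuousM; first exact: kcontinuous_circ.
apply: kcontinuousV => [t|]; first exact: circ_neq.
by apply: kcontinuousB; [exact: kcontinuous_circ|exact: kcontinuous_cst].
Qed.

Lemma holo_circle f rho r : holo_disc f rho -> 0 <= r < rho -> kcontinuous (fun t => f (circ r t)).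
Proof.
move=> H /andP[r0 rr]; apply: kcontinuous_circle => // z zr; apply: holo_ccont; apply: H.
by rewrite zr.
Qed.

(** The mean does not depend on the radius as long as this exceeds [nc w], and the kernel tends to 1
    uniformly as the radius grows. *)
Lemma mean_kernel r w : nc w < r -> cmean (fun z => z / (z - w)) r = 1.
Proof.
move=> wr; have r0 : 0 < r := le_lt_trans (nc_ge0 _) wr.
apply/eqP; rewrite -subr_eq0; apply/eqP/nc_le_eps_eq0 => e e0.
(* This radius gives [nc w <= e * (s - nc w)], so the kernel differs from 1 by at most [e] on the
   circle. *)
pose s := r + nc w / e.
have rs : r <= s by rewrite lerDl divr_ge0// ?nc_ge0// ltW.
have ws : nc w < s := lt_le_trans wr rs.
rewrite (@cmean_annulus _ _ r s)//; last first.
  move=> z /andP[rz _]; apply: holoM; first exact: holo_id.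
  apply: holoV; first by apply: disc_neq; exact: lt_le_trans rz.
  by apply: holoB; [exact: holo_id|exact: holo_cst].
rewrite -(mean_cst 1) -(meanB (kcontinuous_kernel ws)); last exact: kcontinuous_cst.
apply: mean_bound.
  by apply: kcontinuousB; [exact: kcontinuous_kernel|exact: kcontinuous_cst].
move=> t; have nz := circ_neq t ws.
have -> : circ s t / (circ s t - w) - 1 = w / (circ s t - w) by field.
rewrite ncM ncV ler_pdivrMr ?nc_gt0//.
have s0 : 0 <= s by rewrite (le_trans (nc_ge0 w))// ltW.
rewrite (@le_trans _ _ (e * (s - nc w)))//; last first.
  by rewrite ler_pM2l// -{1}(nc_circ t s0) ncB_ge.
rewrite /s mulrBr mulrDr [e * (_ / _)]mulrC divfK ?gt_eqF// addrAC lerDr -mulrBr.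
by rewrite mulr_ge0 ?ltW// subr_gt0.
Qed.

Lemma cauchy_formula f rho r w : holo_disc f rho -> nc w < r -> r < rho ->
  f w = cmean (fun z => f z * (z / (z - w))) r.
Proof.
move=> H wr rr; have r0 : 0 <= r by rewrite (le_trans (nc_ge0 w))// ltW.
have wrho := lt_trans wr rr.
(* [g] is continuous and vanishes at [0], so its mean over the circle is [0]. *)
pose g z := if z == w then cder f w * w else (f z - f w) * (z / (z - w)).
have gw z : z != w -> g z = (f z - f w) * (z / (z - w)) by rewrite /g => /negPf ->.
have g0 : g 0 = 0.
  rewrite /g; case: eqP => [<-|_]; first by rewrite mulr0.
  by rewrite mul0r mulr0.
have hg z : nc z < rho -> z != w -> holo g z.
  move=> zr zw.
  apply: (@near_eq_holo _ (fun z => (f z - f w) * (z / (z - w)))).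
    apply/near_nc; exists (nc (z - w)); first by rewrite nc_gt0 subr_eq0.
    move=> u uz; rewrite gw//; apply: contraTneq uz => ->.
    by rewrite nc_distC ltxx.
  apply: holoM; first by apply: holoB; [exact: H|exact: holo_cst].
  apply: holoM; first exact: holo_id.
  apply: holoV; first by rewrite subr_eq0.
  by apply: holoB; [exact: holo_id|exact: holo_cst].
have cg : ccont g w.
  (* The difference quotient of [f] at [w], completed by its limit; [g] is [h] times the
     identity. *)
  pose h z := if z == w then cder f w else (f z - f w) / (z - w).
  have -> : g = (fun z => h z * z).
    apply/funext => z; rewrite /g /h; case: eqP => [->//|_].
    by rewrite -mulrA [_^-1 * _]mulrC.
  apply: ccontM; last by apply: holo_ccont; exact: holo_id.
  apply: nc_ccont => e e0.
  have e2 : 0 < e / 2 by rewrite divr_gt0.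
  have [d d0 Hd] := holo_nc (H w wrho) e2.
  exists d => // z zd; rewrite /h eqxx; case: eqP => [_|/eqP zw].
    by rewrite subrr nc0.
  have zw0 : z - w != 0 by rewrite subr_eq0.
  have -> : (f z - f w) / (z - w) - cder f w = (f z - f w - cder f w * (z - w)) / (z - w) by field.
  rewrite ncM ncV ltr_pdivrMr ?nc_gt0//.
  apply: le_lt_trans (Hd _ zd) _; rewrite ltr_pM2r ?nc_gt0//.
  by rewrite ltr_pdivrMr// ltr_pMr// ltr1n.
have /eqP : cmean g r = 0.
  by rewrite (mean_value (p := w) (rho := rho))// r0.
have c1 := holo_circle H (r := r); rewrite r0 rr in c1; have {}c1 := c1 isT.
have c2 := kcontinuous_kernel wr.
have -> : cmean g r = cmean (fun z => f z * (z / (z - w))) r - f w * cmean (fun z => z / (z - w)) r.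
  rewrite /cmean -(meanM _ c2) -(meanB (kcontinuousM c1 c2) (kcontinuousZ _ c2)).
  apply: mean_ext => t; rewrite gw; last by rewrite -subr_eq0 circ_neq.
  by rewrite mulrBl.
by rewrite mean_kernel// mulr1 subr_eq0 => /eqP.
Qed.

(** Differentiation under the mean. The second-order remainder is uniform in [t], so a norm estimate
    of the mean suffices and no limit is exchanged with the integral. *)
Lemma mean_holo (k : C -> R -> C) (k' : R -> C) w (d B : R) : 0 < d -> 0 <= B ->
  (forall z, nc (z - w) < d -> kcontinuous (k z)) -> kcontinuous k' ->
  (forall z t, nc (z - w) < d -> 0 <= t <= 2 * pi ->
     nc (k z t - k w t - (z - w) * k' t) <= B * nc (z - w) ^+ 2) ->
  holo (fun z => mean (k z)) w /\ cder (fun z => mean (k z)) w = mean k'.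
Proof.
move=> d0 B0 ck ck' Hk; apply: nc_holo => e e0.
have B1 : 0 < B + 1 by rewrite ltr_wpDl.
exists (Num.min d (e / (B + 1))); first by rewrite lt_min d0 divr_gt0.
move=> z; rewrite lt_min => /andP[zd ze].
have cz := ck z zd.
have cw : kcontinuous (k w) by apply: ck; rewrite subrr nc0.
have c1 := kcontinuousB cz cw; have c2 := kcontinuousZ (z - w) ck'.
rewrite [mean k' * _]mulrC -(meanM _ ck') -(meanB cz cw) -(meanB c1 c2).
have pi2 : 0 < 2 * pi :> R by rewrite mulr_gt0// pi_gt0.
rewrite /mean ncM nc_real ger0_norm; last by rewrite invr_ge0 ltW.
rewrite mulrC ler_pdivrMr//.
have -> : e * nc (z - w) * (2 * pi) = e * nc (z - w) * (2 * pi - 0) by rewrite subr0.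
apply: CI_bound; first exact: ltW.
  by move=> t _; apply: kcontB; [exact: c1|exact: c2].
move=> t tp; apply: le_trans (Hk z t zd tp) _; rewrite expr2 mulrA ler_wpM2r ?nc_ge0//.
move: ze; rewrite ltr_pdivlMr// mulrDr mulr1 => ze.
by rewrite mulrC; apply: le_trans (ltW ze); rewrite lerDl nc_ge0.
Qed.

Lemma kcontinuous_bounded F : kcontinuous F ->
  exists2 B, 0 <= B & forall t, 0 <= t <= 2 * pi -> nc (F t) <= B.
Proof.
move=> cF; have pi2 : 0 <= 2 * pi :> R by rewrite mulr_ge0// pi_ge0.
have [|c _ Hc] := @EVT_max R (fun t => nc (F t)) _ _ pi2.
  by apply: continuous_subspaceT; exact: kcontinuous_nc.
exists (nc (F c)); first exact: nc_ge0.
by move=> t tp; apply: Hc; rewrite in_itv.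
Qed.

(** * Derivatives of integrals of Cauchy type *)

Section kernels.
Variables (phi : R -> C) (r : R) (w : C).
Hypotheses (cphi : kcontinuous phi) (wr : nc w < r).
Let r0 : 0 < r. Proof. exact: le_lt_trans (nc_ge0 w) wr. Qed.

Let dl : 0 < r - nc w. Proof. by rewrite subr_gt0. Qed.

Let near_disc z : nc (z - w) < (r - nc w) / 2 ->
  nc z < r /\ forall t, (r - nc w) / 2 <= nc (circ r t - z).
Proof.
move=> zw; have zn : nc z <= nc w + (r - nc w) / 2.
  by rewrite -[z](subrK w) addrC (le_trans (ncD _ _))// lerD2l ltW.
split; first by apply: le_lt_trans zn _; move: wr; lra.
move=> t; apply: le_trans (ncB_ge _ _); rewrite (nc_circ _ (ltW r0)); move: zn; lra.
Qed.

Let far t : r - nc w <= nc (circ r t - w).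
Proof. by apply: le_trans (ncB_ge _ _); rewrite (nc_circ _ (ltW r0)). Qed.

Let kc1 z n : nc z < r -> kcontinuous (fun t => ((circ r t - z)^-1) ^+ n).
Proof.
move=> zr; elim: n => [|n IHn].
  by under eq_fun do rewrite expr0; exact: kcontinuous_cst.
under eq_fun do rewrite exprS; apply: kcontinuousM; last exact: IHn.
apply: kcontinuousV => [t|]; first exact: circ_neq.
by apply: kcontinuousB; [exact: kcontinuous_circ|exact: kcontinuous_cst].
Qed.

Lemma holo_kernel1 :
  holo (fun z => mean (fun t => phi t * (circ r t - z)^-1 ^+ 1)) w /\
  cder (fun z => mean (fun t => phi t * (circ r t - z)^-1 ^+ 1)) w =
   mean (fun t => phi t * (circ r t - w)^-1 ^+ 2).
Proof.
have [B B0 HB] := kcontinuous_bounded cphi.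
pose D := r - nc w; have D0 : 0 < D := dl.
have nearD z : nc (z - w) < D / 2 -> nc z < r /\ forall t, D / 2 <= nc (circ r t - z) := @near_disc z.
have farD t : D <= nc (circ r t - w) := far t.
clearbody D.
have D2 : 0 < D / 2 by rewrite divr_gt0.
apply: (@mean_holo (fun z t => phi t * (circ r t - z)^-1 ^+ 1) _ w (D / 2) (B * ((D / 2)^-1 * D^-1 ^+ 2)) D2).
- by rewrite !mulr_ge0// ?exprn_ge0// invr_ge0 ltW.
- by move=> z /nearD[zr _]; apply: kcontinuousM; [exact: cphi|exact: kc1].
- by apply: kcontinuousM; [exact: cphi|exact: kc1].
move=> z t zw tp; have [zr zfar] := nearD _ zw.
have n1 := circ_neq t zr; have n2 := circ_neq t wr.
set Z := circ r t in n1 n2 *.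
have -> : phi t * (Z - z)^-1 ^+ 1 - phi t * (Z - w)^-1 ^+ 1 - (z - w) * (phi t * (Z - w)^-1 ^+ 2)
  = phi t * ((Z - z)^-1 * (Z - w)^-1 ^+ 2) * (z - w) ^+ 2.
  by field; rewrite ?n1 ?n2.
rewrite !(ncX, ncM, ncV) ler_wpM2r ?exprn_ge0 ?nc_ge0//.
rewrite ler_pM ?nc_ge0 ?HB// ?mulr_ge0 ?exprn_ge0 ?invr_ge0 ?nc_ge0//.
have i1 : (nc (Z - z))^-1 <= (D / 2)^-1 by rewrite lef_pV2 ?posrE ?nc_gt0// zfar.
have i2 : (nc (Z - w))^-1 <= D^-1 by rewrite lef_pV2 ?posrE ?nc_gt0// farD.
by rewrite ler_pM ?exprn_ge0 ?invr_ge0 ?nc_ge0// lerXn2r ?nnegrE ?invr_ge0 ?nc_ge0// ltW.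
Qed.

(** By [cauchy_cder] the derivative of an entire function is a mean of this form, so this is what
    makes derivatives holomorphic again. *)
Lemma holo_kernel2 :
  holo (fun z => mean (fun t => phi t * (circ r t - z)^-1 ^+ 2)) w.
Proof.
have [B B0 HB] := kcontinuous_bounded cphi.
pose D := r - nc w; have D0 : 0 < D := dl.
have nearD z : nc (z - w) < D / 2 -> nc z < r /\ forall t, D / 2 <= nc (circ r t - z) := @near_disc z.
have farD t : D <= nc (circ r t - w) := far t.
clearbody D.
have D2 : 0 < D / 2 by rewrite divr_gt0.
suff [] : holo (fun z => mean (fun t => phi t * (circ r t - z)^-1 ^+ 2)) w /\
  cder (fun z => mean (fun t => phi t * (circ r t - z)^-1 ^+ 2)) w =
   mean (fun t => 2 * phi t * (circ r t - w)^-1 ^+ 3) by [].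
(* The factor [8 * r] is a crude bound for the numerator [3 * Z - (w + 2 * z)] of the remainder,
   where all three points lie in the closed disc of radius [r]. *)
apply: (@mean_holo (fun z t => phi t * (circ r t - z)^-1 ^+ 2) _ w (D / 2) (B * ((D / 2)^-1 ^+ 2 * D^-1 ^+ 3 * (8 * r))) D2).
- by rewrite !mulr_ge0// ?exprn_ge0 ?invr_ge0 ?ltW// ltW.
- by move=> z /nearD[zr _]; apply: kcontinuousM; [exact: cphi|exact: kc1].
- by apply: kcontinuousM; [exact: kcontinuousZ | exact: kc1].
move=> z t zw tp; have [zr zfar] := nearD _ zw.
have n1 := circ_neq t zr; have n2 := circ_neq t wr.
have nZ := nc_circ t (ltW r0).
set Z := circ r t in n1 n2 nZ *.
have -> : phi t * (Z - z)^-1 ^+ 2 - phi t * (Z - w)^-1 ^+ 2 - (z - w) * (2 * phi t * (Z - w)^-1 ^+ 3)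
  = phi t * ((Z - z)^-1 ^+ 2 * (Z - w)^-1 ^+ 3 * (3 * (Z - w) - 2 * (z - w))) * (z - w) ^+ 2.
  by field; rewrite ?n1 ?n2.
rewrite !(ncX, ncM, ncV) ler_wpM2r ?exprn_ge0 ?nc_ge0//.
rewrite ler_pM ?nc_ge0 ?HB// ?mulr_ge0 ?exprn_ge0 ?invr_ge0 ?nc_ge0//.
have i1 : (nc (Z - z))^-1 <= (D / 2)^-1 by rewrite lef_pV2 ?posrE ?nc_gt0// zfar.
have i2 : (nc (Z - w))^-1 <= D^-1 by rewrite lef_pV2 ?posrE ?nc_gt0// farD.
have i3 : nc (3 * (Z - w) - 2 * (z - w)) <= 8 * r.
  have -> : 3 * (Z - w) - 2 * (z - w) = 3%:R * Z - (w + 2%:R * z) by ring.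
  apply: (le_trans (ncB _ _)); rewrite ncM nZ.
  have := ncD w (2%:R * z); rewrite [X in _ <= _ + X]ncM.
  have nn n : nc (n%:R : C) = n%:R.
    have -> : n%:R = (n%:R : R)%:C :> C by rewrite rmorph_nat.
    by rewrite nc_real normr_nat.
  rewrite !nn => i4; move: wr zr r0; lra.
rewrite !ler_pM ?mulr_ge0 ?exprn_ge0 ?invr_ge0 ?nc_ge0//.
Qed.
End kernels.

(** * Entire functions: Cauchy estimates, maximum principle, Liouville *)

Definition centire f := forall z, holo f z.

Lemma centire_disc f rho : centire f -> holo_disc f rho.
Proof. by move=> Ef z _; exact: Ef. Qed.

Lemma centire_circle f r : centire f -> 0 <= r -> kcontinuous (fun t => f (circ r t)).
Proof. by move=> Ef; apply: kcontinuous_circle => z _; exact: holo_ccont (Ef z). Qed.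

Lemma near_cder f g z : knear z (fun w => f w = g w) -> holo g z -> cder f z = cder g z.
Proof.
move=> /near_nc[d1 d10 H1] hg.
suff [] : holo f z /\ cder f z = cder g z by [].
apply: nc_holo => e e0; have [d2 d20 H2] := holo_nc hg e0.
exists (Num.min d1 d2); first by rewrite lt_min d10.
move=> w; rewrite lt_min => /andP[/H1 -> /H2].
by rewrite H1// subrr nc0.
Qed.

Lemma cauchy_cder f w r : centire f -> nc w < r ->
  cder f w = mean (fun t => f (circ r t) * circ r t * (circ r t - w)^-1 ^+ 2).
Proof.
move=> Ef wr; have r0 : 0 <= r by rewrite (le_trans (nc_ge0 w))// ltW.
have cphi : kcontinuous (fun t => f (circ r t) * circ r t).
  apply: kcontinuousM; last exact: kcontinuous_circ.
  exact: centire_circle.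
have [h1 <-] := holo_kernel1 cphi wr.
apply: near_cder => //; apply/near_nc; exists (r - nc w); first by rewrite subr_gt0.
move=> z zw; have zr : nc z < r.
  by rewrite -[z](subrK w) (le_lt_trans (ncD _ _))// -ltrBrDr.
rewrite [LHS](cauchy_formula (centire_disc (rho := r + 1) Ef) zr); last by rewrite ltrDl.
by apply: mean_ext => t; rewrite expr1 mulrA.
Qed.

Lemma centire_cder f : centire f -> centire (cder f).
Proof.
move=> Ef w; pose r := nc w + 1.
have wr : nc w < r by rewrite ltrDl.
have r0 : 0 <= r by rewrite (le_trans (nc_ge0 w))// ltW.
have cphi : kcontinuous (fun t => f (circ r t) * circ r t).
  apply: kcontinuousM; last exact: kcontinuous_circ.
  exact: centire_circle.
apply: near_eq_holo (holo_kernel2 cphi wr).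
apply/near_nc; exists 1 => // z zw; rewrite (cauchy_cder Ef (r := r))//.
by rewrite -[z](subrK w) (le_lt_trans (ncD _ _))// addrC ltrD2l.
Qed.

Lemma cder_shift f w : centire f -> cder (fun z => f (z + w)) 0 = cder f w.
Proof.
move=> Ef; suff [] : holo (fun z => f (z + w)) 0 /\ cder (fun z => f (z + w)) 0 = cder f w by [].
apply: nc_holo => e e0; have [d d0 Hd] := holo_nc (Ef w) e0.
exists d => // z; rewrite subr0 => zd.
by have := Hd (z + w); rewrite addrK add0r; exact.
Qed.

Lemma centire_shift f w : centire f -> centire (fun z => f (z + w)).
Proof.
move=> Ef z; apply: (@holo_comp _ f (fun z => z + w)) => //.
Qed.

(** Cauchy's estimate with radius 1 has constant 1. Iterating it costs one unit of radius per
    derivative and no factor, whence the radius [k%:R] in [nderiv_bound]. *)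
Lemma cder_bound f w B : centire f -> (forall z, nc (z - w) <= 1 -> nc (f z) <= B) ->
  nc (cder f w) <= B.
Proof.
move=> Ef HB; rewrite -cder_shift//; have Eg := centire_shift w Ef.
have n01 : nc (0 : C) < 1 by rewrite nc0.
rewrite (cauchy_cder Eg n01); apply: mean_bound.
  apply: kcontinuousM.
    apply: kcontinuousM; last exact: kcontinuous_circ.
    exact: (centire_circle Eg ler01).
  have kV : kcontinuous (fun t => (circ 1 t - 0)^-1).
    apply: kcontinuousV => [t|]; first exact: circ_neq.
    by apply: kcontinuousB; [exact: kcontinuous_circ|exact: kcontinuous_cst].
  exact: (kcontinuousM kV kV).
move=> t; rewrite !(ncX, ncM, ncV) subr0 nc_circ// invr1 expr1n !mulr1.
by apply: HB; rewrite addrK nc_circ.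
Qed.

Lemma nderivS k f : nderiv k.+1 f = cder (nderiv k f).
Proof. by []. Qed.

Lemma centire_nderiv k f : centire f -> centire (nderiv k f).
Proof. by move=> Ef; elim: k => [//|k IHk]; rewrite nderivS; exact: centire_cder. Qed.

Lemma nderiv_bound k f w B : centire f -> (forall z, nc (z - w) <= k%:R -> nc (f z) <= B) ->
  nc (nderiv k f w) <= B.
Proof.
move=> Ef; elim: k w => [|k IHk] w HB; first by apply: HB; rewrite subrr nc0.
rewrite nderivS; apply: cder_bound; first exact: centire_nderiv.
move=> z zw; apply: IHk => u uz; apply: HB.
have -> : u - w = (u - z) + (z - w) by ring.
by rewrite (le_trans (ncD _ _))// -natr1 lerD.
Qed.

Lemma bernoulli_unbounded (q M : R) : 1 < q -> exists n, M < q ^+ n.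
Proof.
move=> q1; have B n : 1 + n%:R * (q - 1) <= q ^+ n.
  elim: n => [|n IHn]; first by rewrite mul0r addr0 expr0.
  rewrite exprS; have q0 : 0 <= q - 1 by lra.
  have := ler_wpM2l (_ : 0 <= q) IHn; rewrite (_ : 0 <= q)//; last by lra.
  move=> /(_ isT); apply: le_trans; rewrite -natr1.
  have := mulr_ge0 (mulr_ge0 (ler0n R n) q0) q0; nra.
exists (Num.bound (`|M| / (q - 1))).
have q0 : 0 < q - 1 by lra.
have := archi_boundP (divr_ge0 (normr_ge0 M) (ltW q0)).
rewrite ltr_pdivrMr// => H; have := B (Num.bound (`|M| / (q - 1))).
have := ler_norm M; lra.
Qed.

(* Cauchy's formula for [f ^+ n] loses a factor [M] independent of [n]. *)
Lemma max_principle f rho r w B : holo_disc f rho -> nc w < r -> r < rho ->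
  (forall z, nc z = r -> nc (f z) <= B) -> nc (f w) <= B.
Proof.
move=> H wr rr HB; have r0 : 0 < r := le_lt_trans (nc_ge0 _) wr.
pose M := r / (r - nc w).
have M0 : 0 < M by rewrite divr_gt0// subr_gt0.
have B0 : 0 <= B by apply: le_trans (nc_ge0 _) (HB (circ r 0) (nc_circ _ (ltW r0))).
have K n : nc (f w) ^+ n <= B ^+ n * M.
  have Hn : holo_disc (fun z => f z ^+ n) rho by move=> z zr; apply: holoX; exact: H.
  rewrite -ncX (cauchy_formula Hn wr rr); apply: mean_bound.
    apply: kcontinuousM; last exact: kcontinuous_kernel.
    by apply: (holo_circle Hn); rewrite ltW.
  move=> t; rewrite ncM ncX ler_pM ?exprn_ge0 ?nc_ge0//.
    by rewrite lerXn2r ?nnegrE ?nc_ge0// HB// nc_circ// ltW.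
  rewrite ncM ncV (nc_circ _ (ltW r0)) (ler_wpM2l (ltW r0))// lef_pV2 ?posrE ?nc_gt0 ?circ_neq ?subr_gt0//.
  by apply: le_trans (ncB_ge _ _); rewrite nc_circ// ltW.
rewrite leNgt; apply/negP => Bf.
move: B0; rewrite le_eqVlt => /predU1P[B0|B0].
  by have := K 1%N; rewrite !expr1 -B0 mul0r leNgt (le_lt_trans _ Bf)// -B0.
have q1 : 1 < nc (f w) / B by rewrite ltr_pdivlMr// mul1r.
have [n] := bernoulli_unbounded M q1.
by rewrite expr_div_n ltr_pdivlMr ?exprn_gt0// mulrC ltNge K.
Qed.

Lemma liouville f B : centire f -> (forall z, nc (f z) <= B) -> forall w, f w = f 0.
Proof.
move=> Ef HB w; apply/eqP; rewrite -subr_eq0; apply/eqP/nc_le_eps_eq0 => e e0.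
have B0 : 0 <= B := le_trans (nc_ge0 _) (HB 0).
(* The two Cauchy kernels differ by [w / (z - w)], and this radius makes [B * nc w / (r - nc w)] at
   most [e]. *)
pose r := nc w + B * nc w / e + 1.
have p0 : 0 <= B * nc w / e by rewrite divr_ge0 ?mulr_ge0 ?nc_ge0// ltW.
have wr : nc w < r by rewrite /r; lra.
have r0 : 0 < r := le_lt_trans (nc_ge0 _) wr.
have rr : r < r + 1 by rewrite ltrDl.
have n0 : nc (0 : C) < r by rewrite nc0.
have cf : kcontinuous (fun t => f (circ r t)).
  by apply: centire_circle => //; exact: ltW.
have c1 := kcontinuousM cf (kcontinuous_kernel wr).
have c2 := kcontinuousM cf (kcontinuous_kernel n0).
rewrite (cauchy_formula (centire_disc (rho := r + 1) Ef) wr rr) (cauchy_formula (centire_disc (rho := r + 1) Ef) n0 rr).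
rewrite /cmean -(meanB c1 c2); apply: mean_bound; first exact: kcontinuousB.
move=> t; have n1 := circ_neq t wr; have n2 := circ_neq t n0.
set z := circ r t in n1 n2 *; rewrite subr0 in n2.
have -> : f z * (z / (z - w)) - f z * (z / (z - 0)) = f z * (w / (z - w)).
  by field; rewrite ?n1 ?n2.
rewrite ncM ncM ncV mulrA ler_pdivrMr ?nc_gt0//.
apply: (@le_trans _ _ (B * nc w)); first by rewrite ler_wpM2r ?nc_ge0.
have zr : r - nc w <= nc (z - w) by apply: le_trans (ncB_ge _ _); rewrite nc_circ// ltW.
rewrite -[leLHS](divfK (lt0r_neq0 e0)) mulrC ler_wpM2l//; first exact: ltW.
apply: le_trans zr; have -> : r - nc w = B * nc w / e + 1 by rewrite /r; ring.
by rewrite lerDl.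
Qed.
End Cauchy.

(** * Poisson majorants *)

Section LogPlus.
Context {R : realType}.
Local Notation C := R[i].
Implicit Types (x y : R).

(** In this form the argument of [ln] is always positive, so monotonicity and continuity pass from
    [ln] to [logp]. *)
Lemma logpE x : logp x = ln (Num.max 1 x).
Proof.
rewrite /logp; have [x1|x1] := leP x 1.
  rewrite ln1; apply/max_idPl; exact: ln_le0.
by apply/max_idPr; rewrite ln_ge0// ltW.
Qed.

Lemma logp_ge0 x : 0 <= logp x.
Proof. by rewrite /logp le_max lexx. Qed.

Lemma le_logp x y : x <= y -> logp x <= logp y.
Proof.
move=> xy; rewrite !logpE ler_ln ?posrE ?lt_max ?ltr01//.
by rewrite ge_max !le_max lexx xy orbT.
Qed.

Lemma le_expR_logp x : x <= expR (logp x).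
Proof. by rewrite logpE lnK ?posrE ?lt_max ?ltr01// le_max lexx orbT. Qed.

Lemma logp_expR x : 0 <= x -> logp (expR x) = x.
Proof. by move=> x0; rewrite /logp expRK; exact/max_idPr. Qed.

Lemma logpM x y : 0 <= x -> 0 <= y -> logp (x * y) <= logp x + logp y.
Proof.
move=> x0 y0; rewrite -[leRHS]logp_expR ?addr_ge0 ?logp_ge0//.
by apply: le_logp; rewrite expRD ler_pM// le_expR_logp.
Qed.

Lemma logpX2 x : 0 <= x -> logp (x ^+ 2) = 2 * logp x.
Proof.
move=> x0; rewrite /logp.
have [->|xp] := eqVneq x 0; first by rewrite expr0n/= ln0// maxxx mulr0.
by rewrite maxr_pMr// mulr0 mulr_natl lnXn// lt0r xp.
Qed.

Lemma logpD x y : 0 <= x -> 0 <= y -> logp (x + y) <= ln 2 + logp x + logp y.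
Proof.
move=> x0 y0.
have p : 0 <= ln 2 + logp x + logp y by rewrite !addr_ge0 ?logp_ge0// ln_ge0// ler1n.
rewrite -[leRHS]logp_expR//; apply: le_logp.
rewrite !expRD lnK ?posrE// -mulrA.
have h1 : 1 <= expR (logp x) by rewrite -expR0 ler_expR logp_ge0.
have h2 : 1 <= expR (logp y) by rewrite -expR0 ler_expR logp_ge0.
(* Since [X] and [Y] are at least 1, [x + y <= X + Y <= 2 * (X * Y)]. *)
have := le_expR_logp x; have := le_expR_logp y.
set X := expR _ in h1 *; set Y := expR _ in h2 *; nra.
Qed.

Lemma continuous_logp : continuous (@logp R).
Proof.
have -> : @logp R = fun x => ln (Num.max 1 x) by apply/funext => x; exact: logpE.
move=> x; apply: continuous_comp; last by apply: continuous_ln; rewrite lt_max ltr01.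
by apply: continuous_max; [exact: cvg_cst|exact: cvg_id].
Qed.

Lemma ccont_logp (f : C -> C) w : ccont f w -> forall e, 0 < e ->
  exists2 d, 0 < d & forall z, nc (z - w) < d -> `|logp (nc (f z)) - logp (nc (f w))| < e.
Proof.
move=> cf e e0.
have [d d0 Hd] := (rcont_eps _ _).1 (@continuous_logp (nc (f w))) e e0.
have [d' d'0 Hd'] := ccont_nc cf d0.
exists d' => // z /Hd' zw; apply: Hd; apply: le_lt_trans zw.
rewrite ler_norml ncB_ge andbT lerNl opprB nc_distC; exact: ncB_ge.
Qed.
End LogPlus.

(** * Schwarz and Poisson integrals, Harnack's inequality *)

Section Poisson.
Context {R : realType}.
Local Notation C := R[i].
Variables (u : R -> R) (r : R).
Hypotheses (cu : continuous u) (u0 : forall t, 0 <= u t) (r0 : 0 < r).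
Implicit Types (z w : C) (t s : R).

(** The usual kernel [(Z + z) / (Z - z)] is written as [2 * Z / (Z - z) - 1]: the first term is of
    Cauchy type, so [holo_kernel1] applies, and the second gives the constant [rmean u]. *)
Definition schwarz z : C :=
  mean (fun t => 2 * (u t)%:C * circ r t * (circ r t - z)^-1 ^+ 1) - (rmean u)%:C.

Definition pkernel z t : R := (r ^+ 2 - nc z ^+ 2) / nc (circ r t - z) ^+ 2.

Definition poisson z : R := rmean (fun t => u t * pkernel z t).

Lemma kcontinuous_real (x : R -> R) : continuous x -> kcontinuous (fun t => (x t)%:C).
Proof. by move=> cx t; apply: kcont_real; exact: cx. Qed.

Let kphi : kcontinuous (fun t => 2 * (u t)%:C * circ r t).
Proof.
apply: kcontinuousM; last exact: kcontinuous_circ.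
exact: (kcontinuousZ 2 (kcontinuous_real cu)).
Qed.

Lemma schwarz_holo : holo_disc schwarz r.
Proof.
move=> z zr; apply: holoB; last exact: holo_cst.
by have [] := holo_kernel1 kphi zr.
Qed.

Lemma Re_inv z : Re z^-1 = Re z / nc z ^+ 2.
Proof. by rewrite nc_sqr; case: z. Qed.

Lemma Im_inv z : Im z^-1 = - Im z / nc z ^+ 2.
Proof. by rewrite nc_sqr; case: z => a b /=; rewrite mulNr. Qed.

(** With [Z = circ r t], twice the real part of [Z] times the conjugate of [Z - z] equals
    [r ^+ 2 - nc z ^+ 2 + nc (Z - z) ^+ 2]; dividing by the last square leaves the Poisson kernel
    plus 1. *)
Lemma Re_kernel z t : nc z < r ->
  Re (2 * (u t)%:C * circ r t * (circ r t - z)^-1 ^+ 1) = u t * pkernel z t + u t.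
Proof.
move=> zr; have n0 := circ_neq t zr.
have := nc_sqr (circ r t); rewrite (nc_circ t (ltW r0)) /pkernel => ->.
rewrite expr1; set Z := circ r t in n0 *.
have n1 : nc (Z - z) ^+ 2 != 0 by rewrite expf_neq0// nc_eq0.
have -> : 2 * (u t)%:C * Z * (Z - z)^-1 = (2 * u t)%:C * (Z * (Z - z)^-1).
  by rewrite rmorphM/= rmorph_nat mulrA.
rewrite Re_mul /= mul0r subr0 Re_mul Re_inv Im_inv.
have E := nc_sqr (Z - z); set N := nc (Z - z) ^+ 2 in n1 E *.
rewrite nc_sqr; rewrite !Re_add !Im_add !Re_opp !Im_opp in E *.
transitivity (2 * u t * (Re Z * (Re Z - Re z) + Im Z * (Im Z - Im z)) / N); first by field.
transitivity (u t * ((Re Z ^+ 2 + Im Z ^+ 2 - (Re z ^+ 2 + Im z ^+ 2)) + N) / N); last by rewrite /Z /=; field.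
by congr (_ / N); rewrite E; ring.
Qed.

Lemma continuous_pkernel z : nc z < r -> continuous (pkernel z).
Proof.
move=> zr.
have c1 : kcontinuous (fun t => (circ r t - z)^-1).
  apply: kcontinuousV => [t|]; first exact: circ_neq.
  by apply: kcontinuousB; [exact: kcontinuous_circ|exact: kcontinuous_cst].
have c2 := kcontinuous_nc c1.
have -> : pkernel z = fun t => (r ^+ 2 - nc z ^+ 2) * (nc (circ r t - z)^-1 * nc (circ r t - z)^-1).
  by apply/funext => t; rewrite /pkernel ncV expr2 invfM.
move=> t; apply: cvgM; first exact: cvg_cst.
by apply: cvgM; exact: c2.
Qed.

Lemma continuous_upk z : nc z < r -> continuous (fun t => u t * pkernel z t).
Proof. by move=> zr t; apply: cvgM; [exact: cu|exact: continuous_pkernel]. Qed.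

Lemma Re_schwarz z : nc z < r -> Re (schwarz z) = poisson z.
Proof.
move=> zr; rewrite /schwarz Re_add Re_opp Re_mean /=.
rewrite (rmean_ext (fun t => Re_kernel t zr)) rmeanD ?addrK//.
exact: continuous_upk.
Qed.

Lemma pkernel_ge0 z t : nc z < r -> 0 <= pkernel z t.
Proof.
move=> zr; rewrite divr_ge0 ?exprn_ge0 ?nc_ge0// subr_ge0 lerXn2r ?nnegrE ?nc_ge0 ?ltW//.
Qed.

Lemma poisson_ge0 z : nc z < r -> 0 <= poisson z.
Proof. by move=> zr; apply: rmean_ge0 => t; rewrite mulr_ge0 ?pkernel_ge0. Qed.

Lemma poisson0 : poisson 0 = rmean u.
Proof.
apply: rmean_ext => t; rewrite /pkernel nc0 subr0 (nc_circ t (ltW r0)) expr0n/= subr0.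
by rewrite divff ?mulr1// expf_neq0// gt_eqF.
Qed.

Lemma continuous_poisson s : 0 <= s < r -> continuous (fun t => poisson (circ s t)).
Proof.
move=> /andP[s0 sr].
have -> : (fun t => poisson (circ s t)) = (fun t => Re (schwarz (circ s t))).
  by apply/funext => t; rewrite Re_schwarz// nc_circ.
apply: kcontinuous_Re; apply: (holo_circle schwarz_holo); exact/andP.
Qed.

Lemma poisson_mean s : 0 <= s < r -> rmean (fun t => poisson (circ s t)) = rmean u.
Proof.
move=> /andP[s0 sr]; rewrite -poisson0 -Re_schwarz ?nc0//.
have n0 : nc (0 : C) < r by rewrite nc0.
rewrite -(mean_value (g := schwarz) (p := 0) (rho := r) (r := s))//.
- rewrite /cmean Re_mean; apply: rmean_ext => t; rewrite Re_schwarz// nc_circ//.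
- exact/andP.
- by apply: holo_ccont; exact: schwarz_holo.
- by move=> z zr _; exact: schwarz_holo.
Qed.

(** The kernels are compared pointwise in [t]. Passing from [z] to [w] enlarges each of [r - nc z]
    and [r + nc z] by a factor at most [(c + d) / c], and shrinks the distance to the boundary point
    by a factor at least [(c - d) / c], because that distance is at least [c]. *)
Lemma harnack z w d c : nc z + c <= r -> 0 <= d -> d < c -> nc (w - z) <= d ->
  poisson w <= ((c + d) / (c - d)) ^+ 2 * poisson z.
Proof.
move=> zc d0 dc wz; have c0 : 0 < c := le_lt_trans d0 dc.
have zr : nc z < r by rewrite (lt_le_trans _ zc)// ltrDl.
have wn : nc w <= nc z + d.
  by rewrite -[w](subrK z) addrC (le_trans (ncD _ _))// lerD2l.
have zn : nc z <= nc w + d.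
  by rewrite -[z](subrK w) addrC (le_trans (ncD _ _))// lerD2l nc_distC.
have wr : nc w < r by move: zc wn dc; lra.
rewrite -rmeanZ; last exact: continuous_upk.
apply: le_rmean; first exact: continuous_upk.
  by move=> t; apply: cvgM; [exact: cvg_cst|exact: continuous_upk].
move=> t; rewrite [leRHS]mulrCA; apply: ler_wpM2l; first exact: u0.
rewrite /pkernel.
have w1 := circ_neq t wr; have z1 := circ_neq t zr.
have nz : c <= nc (circ r t - z).
  by apply: le_trans (ncB_ge _ _); rewrite nc_circ ?(ltW r0)//; move: zc; lra.
have nw : nc (circ r t - z) - d <= nc (circ r t - w).
  have -> : circ r t - w = (circ r t - z) - (w - z) by ring.
  by apply: le_trans (ncB_ge _ _); rewrite lerD2l lerN2.
set Z := nc (circ r t - z) in nz nw *; set W := nc (circ r t - w) in nw *.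
have cd : 0 < c - d by rewrite subr_gt0.
have Z0 : 0 < Z := lt_le_trans c0 nz.
have W1 : (c - d) * Z <= c * W.
  apply: (@le_trans _ _ (c * (Z - d))); last exact: ler_wpM2l (ltW c0) _ _ nw.
  by rewrite mulrBl mulrBr lerD2l lerN2 mulrC ler_wpM2l.
have W0 : 0 < W by rewrite nc_gt0.
have N1 : (r - nc w) * c <= (r - nc z) * (c + d).
  have := ler_wpM2r d0 (_ : c <= r - nc z); move: zc zn => zc zn.
  move=> /(_ ltac:(lra)) K1; have := ler_wpM2r (ltW c0) (_ : r - nc w <= r - nc z + d).
  move=> /(_ ltac:(lra)) K2; lra.
have N2 : (r + nc w) * c <= (r + nc z) * (c + d).
  have nz0 := nc_ge0 z.
  have := ler_wpM2r d0 (_ : c <= r + nc z).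
  move=> /(_ ltac:(lra)) K1; have := ler_wpM2r (ltW c0) (_ : r + nc w <= r + nc z + d).
  move=> /(_ ltac:(lra)) K2; lra.
have -> : ((c + d) / (c - d)) ^+ 2 * ((r ^+ 2 - nc z ^+ 2) / Z ^+ 2) =
   ((r - nc z) * (c + d)) * ((r + nc z) * (c + d)) / ((c - d) * Z) ^+ 2.
  by field; rewrite !gt_eqF.
have -> : (r ^+ 2 - nc w ^+ 2) / W ^+ 2 = ((r - nc w) * c) * ((r + nc w) * c) / (c * W) ^+ 2.
  by field; rewrite !gt_eqF.
have p1 : 0 <= (r - nc w) * c by rewrite mulr_ge0 ?(ltW c0)// subr_ge0 ltW.
have p2 : 0 <= (r + nc w) * c by rewrite mulr_ge0 ?(ltW c0)// addr_ge0 ?nc_ge0// ltW.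
apply: ler_pM.
- exact: mulr_ge0.
- by rewrite invr_ge0 sqr_ge0.
- exact: ler_pM.
- rewrite lef_pV2 ?posrE ?exprn_gt0 ?mulr_gt0//.
  by apply: lerXn2r => //; rewrite nnegrE ltW// mulr_gt0.
Qed.
End Poisson.

(** * Majorants of the logarithm of an entire function *)

Section Majorant.
Context {R : realType}.
Local Notation C := R[i].
Implicit Types (f : C -> C) (r s t : R) (z w : C).

(** For the constant data 1 the Schwarz integral is [2 - 1], by [mean_kernel]. *)
Lemma pkernel_mean r z : nc z < r -> rmean (pkernel r z) = 1.
Proof.
move=> zr; have r0 : 0 < r := le_lt_trans (nc_ge0 _) zr.
have c1 : continuous (fun _ : R => 1 : R) by move=> t; exact: cvg_cst.
have := Re_schwarz c1 r0 zr; rewrite /poisson.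
have -> : rmean (fun t => 1 * pkernel r z t) = rmean (pkernel r z).
  by apply: rmean_ext => t; rewrite mul1r.
move=> <-; rewrite /schwarz rmean_cst.
have -> : mean (fun t => 2 * (1 : R)%:C * circ r t * (circ r t - z)^-1 ^+ 1) = 2 * cmean (fun z' => z' / (z' - z)) r.
  rewrite -(meanM _ (kcontinuous_kernel zr)); apply: mean_ext => t.
  by rewrite rmorph1 mulr1 expr1 mulrA.
by rewrite mean_kernel// mulr1 Re_add Re_opp /=; ring.
Qed.

(** The extreme value theorem is applied on the parameter interval of the circle of radius [r + 1];
    Cauchy's formula carries the bound inside. The denominator of its kernel is at least 1 there, so
    the loss is the factor [r + 1]. *)
Lemma disc_bound f r : centire f -> 0 <= r ->
  exists2 B, 0 <= B & forall z, nc z <= r -> nc (f z) <= B.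
Proof.
move=> Ef r0; have r1 : 0 <= r + 1 by rewrite addr_ge0.
have [B B0 HB] := kcontinuous_bounded (centire_circle Ef r1).
exists (B * (r + 1)); first exact: mulr_ge0.
move=> z zr; have zr1 : nc z < r + 1 by rewrite (le_lt_trans zr)// ltrDl.
rewrite (cauchy_formula (centire_disc (rho := r + 2) Ef) zr1) ?ltrD2l ?ltr1n//.
apply: mean_bound_on.
  by apply: kcontinuousM; [exact: centire_circle|exact: kcontinuous_kernel].
move=> t tp; rewrite !ncM ncV nc_circ//.
rewrite ler_pM ?nc_ge0 ?HB// ?divr_ge0 ?nc_ge0//.
rewrite ler_pdivrMr ?nc_gt0 ?circ_neq// ler_peMr//.
by apply: le_trans (ncB_ge _ _); rewrite nc_circ//; move: zr; lra.
Qed.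

Definition ulog f s t : R := logp (nc (f (circ s t))).

Lemma continuous_ulog f s : (forall t, ccont f (circ s t)) -> continuous (ulog f s).
Proof.
move=> cf t; apply: (@continuous_comp _ _ _ (fun t => nc (f (circ s t))) (@logp R)).
  by apply: kcont_norm; apply: kcont_comp (kcont_circ s t) _.
exact: continuous_logp.
Qed.

(** The data of the circle of radius [s] are placed on a slightly larger circle. The kernel then
    stays continuous on the closed disc of radius [s], and an error of at most 1 takes the place of
    boundary limits. *)
Lemma poisson_majorant f s : centire f -> 0 < s ->
  exists2 r, s < r & forall z, nc z <= s -> nc (f z) <= expR (poisson (ulog f s) r z + 1).
Proof.
move=> Ef s0.
have cu : continuous (ulog f s) by apply: continuous_ulog => t; exact: holo_ccont.
have u0 t : 0 <= ulog f s t by exact: logp_ge0.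
have [B B0 HB] := disc_bound Ef (ltW s0).
pose L := logp B.
have L0 : 0 <= L := logp_ge0 _.
have uL z : nc z <= s -> logp (nc (f z)) <= L by move=> zs; rewrite le_logp// HB.
have pi2 : 0 <= 2 * pi :> R by rewrite mulr_ge0// pi_ge0.
(* Half of the allowed error 1 goes to the oscillation of the logarithm within distance [del] of a
   boundary point, the other half to the kernel beyond that distance. *)
have [|p _|del del0 Hdel] := @compact_unif R 0 (2 * pi)
  (fun t d => forall w, nc (w - circ s t) < d -> `|logp (nc (f w)) - ulog f s t| <= 1 / 2) pi2.
- by move=> t d d' dd' H w wd; apply: H; exact: lt_le_trans dd'.
- have [|d d0 Hd] := ccont_logp (holo_ccont (Ef (circ s p))) (e := 1 / 4); first by lra.
  have d2 : 0 < d / 2 by rewrite divr_gt0.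
  have [d' d'0 Hd'] := (kcont_nc _ _).1 (kcont_circ s p) _ d2.
  exists (Num.min d' (d / 2)); first by rewrite lt_min d'0.
  move=> t _; rewrite lt_min => /andP[/Hd' t1 _] w; rewrite lt_min => /andP[_ w1].
  have a1 : nc (w - circ s p) < d.
    have -> : w - circ s p = (w - circ s t) + (circ s t - circ s p) by ring.
    by rewrite (le_lt_trans (ncD _ _))// (splitr d) ltrD.
  have a2 : nc (circ s t - circ s p) < d.
    by rewrite (lt_trans t1)// ltr_pdivrMr// ltr_pMr// ltr1n.
  have := Hd _ a1; have := Hd _ a2; rewrite /ulog !ltr_norml ler_norml => /andP[? ?] /andP[? ?].
  by apply/andP; split; lra.
(* For [r] close to [s] the kernel is at most [1 / (2 * (L + 1))] at distance [del] from [z]. *)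
pose k := del ^+ 2 / (8 * (L + 1)).
have k0 : 0 < k by rewrite divr_gt0 ?exprn_gt0// mulr_gt0// ltr_wpDl.
(* The first bound keeps points at distance [del] from [circ s t] at distance [del / 2] from
   [circ r t]; the other two give [r ^+ 2 - s ^+ 2 = eta * (2 * s + eta) <= k]. *)
pose eta := Num.min (del / 2) (Num.min s (k / (3 * s))).
have s3 : 0 < 3 * s by rewrite mulr_gt0.
have eta0 : 0 < eta by rewrite !lt_min s0 (divr_gt0 k0 s3) andbT divr_gt0.
pose r := s + eta; have sr : s < r by rewrite ltrDl.
have r0 : 0 < r := lt_trans s0 sr.
have e1 : eta <= del / 2 by rewrite ge_min lexx.
have e2 : r ^+ 2 - s ^+ 2 <= k.
  have h1 : eta <= s by rewrite !ge_min lexx orbT.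
  have h2 : eta <= k / (3 * s) by rewrite !ge_min lexx !orbT.
  rewrite ler_pdivlMr ?mulr_gt0// in h2.
  have -> : r ^+ 2 - s ^+ 2 = eta * (2 * s + eta) by rewrite /r; ring.
  by apply: le_trans h2; rewrite ler_wpM2l ?(ltW eta0)//; lra.
exists r => //.
have on_circle z : nc z = s -> logp (nc (f z)) <= poisson (ulog f s) r z + 1.
  move=> zs; have zr : nc z < r by rewrite zs.
  have cpk := continuous_pkernel zr.
  have cp (c : R) : continuous (fun t => c * pkernel r z t).
    by move=> t; apply: cvgM; [exact: cvg_cst|exact: cpk].
  have -> : logp (nc (f z)) = rmean (fun t => (logp (nc (f z)) - 1 / 2) * pkernel r z t) + 1 / 2.
    by rewrite rmeanZ// pkernel_mean// mulr1 subrK.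
  have -> : poisson (ulog f s) r z + 1 = (poisson (ulog f s) r z + 1 / 2) + 1 / 2 by lra.
  rewrite lerD2r -[X in _ <= _ + X](@rmean_cst R) /poisson -rmeanD//; last 2 first.
  - exact: continuous_upk.
  - by move=> t; exact: cvg_cst.
  apply: le_rmean_on => //.
    by move=> t; apply: cvgD; [exact: continuous_upk|exact: cvg_cst].
  move=> t tp; have P0 := pkernel_ge0 r0 t zr.
  have [near|far] := ltP (nc (z - circ s t)) del.
    have := Hdel t tp z near; rewrite ler_norml => /andP[_ H].
    apply: ler_wpDr; first by lra.
    apply: ler_wpM2r; first exact: P0.
    by rewrite lerBlDr -lerBlDl.
  have zn := circ_neq t zr.
  have D : del / 2 <= nc (circ r t - z).
    have -> : circ r t - z = (circ r t - circ s t) - (z - circ s t) by ring.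
    rewrite nc_distC; apply: le_trans (ncB_ge _ _); rewrite nc_circB /r addrAC subrr add0r.
    rewrite gtr0_norm//; lra.
  have PL : (L + 1) * pkernel r z t <= 1 / 2.
    rewrite /pkernel zs mulrA ler_pdivrMr ?exprn_gt0 ?nc_gt0//.
    apply: (@le_trans _ _ ((L + 1) * k)); first by rewrite ler_wpM2l// addr_ge0.
    have -> : (L + 1) * k = 1 / 2 * (del / 2) ^+ 2.
      by rewrite /k; field; rewrite gt_eqF// ltr_wpDl.
    rewrite ler_wpM2l// lerXn2r ?nnegrE ?nc_ge0// ltW// divr_gt0//.
  have K : (logp (nc (f z)) - 1 / 2) * pkernel r z t <= (L + 1) * pkernel r z t.
    have := uL z; rewrite zs lexx => /(_ isT) ?; rewrite ler_wpM2r//; lra.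
  have := mulr_ge0 (u0 t) P0; lra.
(* Multiplication by [cexp (- H z)] turns the comparison with the majorant into a bound on the
   modulus of a holomorphic function, to which the maximum principle applies. *)
pose H := schwarz (ulog f s) r.
have HR z : nc z < r -> nc (f z * cexp (- H z)) = nc (f z) * expR (- poisson (ulog f s) r z).
  by move=> zr; rewrite ncM nc_cexp Re_opp Re_schwarz.
have circ_le z : nc z = s -> nc (f z * cexp (- H z)) <= expR 1.
  move=> zs; rewrite HR ?zs// expRN ler_pdivrMr ?expR_gt0// -expRD.
  by apply: le_trans (le_expR_logp _) _; rewrite ler_expR addrC on_circle.
have hF : holo_disc (fun z => f z * cexp (- H z)) r.
  move=> z zr; apply: holoM; first exact: Ef.
  apply: holo_comp; last exact: holo_cexp.
  by apply: holoN; exact: schwarz_holo.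
move=> z; rewrite le_eqVlt => /predU1P[zs|zs].
  by apply: le_trans (le_expR_logp _) _; rewrite ler_expR on_circle.
have := max_principle hF zs sr circ_le; rewrite HR; last exact: lt_trans sr.
by rewrite expRN ler_pdivrMr ?expR_gt0// -expRD addrC.
Qed.
End Majorant.

(** * Singularities of meromorphic functions *)

Section Poles.
Context {R : realType}.
Local Notation C := R[i].
Implicit Types (f g : C -> C) (r s t : R) (z w : C).

Lemma entire_centire f : entire f <-> centire f.
Proof. by split=> H z; apply/derivable_holo; exact: H. Qed.

Lemma holomorphic_at_nc f z : holomorphic_at f z <->
  exists2 d : R, 0 < d & forall w, nc (w - z) < d -> holo f w.
Proof.
split=> [/near_nc[d d0 Hd]|[d d0 Hd]].
  by exists d => // w /Hd /derivable_holo.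
by apply/near_nc; exists d => // w /Hd /derivable_holo.
Qed.

Lemma holomorphic_at_holo f z : holomorphic_at f z -> holo f z.
Proof. by move=> /holomorphic_at_nc[d d0]; apply; rewrite subrr nc0. Qed.

(** If [f] were bounded near [z], then [g w = f w * (w - z) ^+ n] would be small at a nearby point,
    against [g z != 0]. Hence [pole_order], chosen by [xget], takes its default 0 at points of
    holomorphy. *)
Lemma pole_not_holo f z n : pole f z n -> ~ holomorphic_at f z.
Proof.
move=> [n0 [g [/holomorphic_at_holo hg gz /dnear_nc[d1 d10 H1]]]] /holomorphic_at_holo hf.
pose G := nc (g z); have G0 : 0 < G by rewrite nc_gt0.
have G2 : 0 < G / 2 by rewrite divr_gt0.
have [d2 d20 H2] := ccont_nc (holo_ccont hg) G2.
have [d3 d30 H3] := ccont_nc (holo_ccont hf) (ltr01 : 0 < (1 : R)).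
pose M := nc (f z) + 1; have M0 : 0 < M by rewrite ltr_wpDl ?nc_ge0.
pose s := Num.min (Num.min d1 d2) (Num.min d3 (Num.min 1 (G / 2 / M))) / 2.
have s20 : 0 < s by rewrite divr_gt0// !lt_min d10 d20 d30 ltr01 divr_gt0.
have [sd1 sd2 sd3 s1 sM] : [/\ s < d1, s < d2, s < d3, s < 1 & s < G / 2 / M].
  have : s < s * 2 by rewrite ltr_pMr// ltr1n.
  by rewrite {2}/s divfK// !lt_min => /and3P[/andP[? ?] ? /andP[]].
pose w := z + s%:C.
have wz : w - z = s%:C by rewrite /w addrAC subrr add0r.
have nw : nc (w - z) = s by rewrite wz nc_real gtr0_norm.
have wne : w != z by rewrite -subr_eq0 -nc_eq0 nw gt_eqF.
have := H1 w wne; rewrite nw => /(_ sd1) fw.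
have := H2 w; rewrite nw => /(_ sd2) gw.
have := H3 w; rewrite nw => /(_ sd3) fwz.
have gE : g w = f w * (w - z) ^+ n.
  by rewrite fw divfK// expf_neq0// subr_eq0.
have gl : G / 2 < nc (g w).
  have := ncB_ge (g z) (g w); rewrite nc_distC -/G; move: gw; lra.
have fM : nc (f w) <= M.
  by rewrite -[f w](subrK (f z)) addrC (le_trans (ncD _ _))// lerD2l ltW.
have : nc (g w) <= M * s.
  rewrite gE ncM ncX nw ler_pM ?nc_ge0 ?exprn_ge0// ?(ltW s20)//.
  by rewrite -[leRHS]expr1 ler_wiXn2l// ltW.
rewrite leNgt; move: sM; rewrite ltr_pdivlMr// => sM.
by rewrite mulrC (lt_trans sM gl).
Qed.

Lemma pole_order_holo f z : holomorphic_at f z -> pole_order f z = 0%N.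
Proof. by move=> hf; apply: xgetPN => n /pole_not_holo; exact. Qed.

Lemma pole_count_entire f r : centire f -> pole_count f r = 0.
Proof.
move=> Ef; apply: fsbig1 => z _; rewrite pole_order_holo//.
by apply/holomorphic_at_nc; exists 1.
Qed.

Lemma characteristic_entire f r : centire f -> characteristic f r = rmean (ulog f r).
Proof.
move=> Ef; rewrite /characteristic /pole_counting.
rewrite (@eq_Rintegral _ _ _ lebesgue_measure _ (fun=> 0)); last first.
  by move=> t _; rewrite !pole_count_entire// subrr mul0r.
by rewrite Rintegral_cst// mul0r pole_count_entire// mul0r !addr0.
Qed.

Lemma meromorphic_isolated f : meromorphic f -> forall z,
  exists2 d : R, 0 < d & forall w, w != z -> nc (w - z) < d -> holomorphic_at f w.
Proof.
move=> mf z.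
have open_disc d w (P : C -> Prop) : (forall u, u != z -> nc (u - z) < d -> P u) ->
  w != z -> nc (w - z) < d -> exists2 d', 0 < d' & forall u, nc (u - w) < d' -> P u.
  move=> HP wz wd; exists (Num.min (nc (w - z)) (d - nc (w - z))).
    by rewrite lt_min nc_gt0 !subr_eq0 subr_gt0 wz.
  move=> u; rewrite lt_min => /andP[u1 u2]; apply: HP.
    by apply: contraTneq u1 => ->; rewrite nc_distC ltxx.
  have -> : u - z = (u - w) + (w - z) by ring.
  by rewrite (le_lt_trans (ncD _ _))// -ltrBrDr.
case: (mf z) => [/holomorphic_at_nc[d d0 Hd]|[n [n0 [g [/holomorphic_at_nc[d1 d10 H1] gz /dnear_nc[d2 d20 H2]]]]]].
  exists d => // w wz wd; apply/holomorphic_at_nc.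
  by apply: (open_disc d) => // u _; exact: Hd.
exists (Num.min d1 d2); first by rewrite lt_min d10.
move=> w wz wd; apply/holomorphic_at_nc; apply: (open_disc _ _ _ _ wz wd) => u uz ud.
have [ud1 ud2] : nc (u - z) < d1 /\ nc (u - z) < d2 by move: ud; rewrite lt_min => /andP.
apply: (@near_eq_holo _ (fun v => g v / (v - z) ^+ n)).
  have [d' d'0 Hd'] := open_disc d2 u (fun v => f v = g v / (v - z) ^+ n) H2 uz ud2.
  by apply/near_nc; exists d' => // v /Hd' ->.
apply: holoM; first exact: H1.
apply: holoV; first by rewrite expf_neq0// subr_eq0.
by apply: holoX; apply: holoB; [exact: holo_id|exact: holo_cst].
Qed.

Definition singular f : set C := [set z | ~ holomorphic_at f z].

(** Singularities are isolated, so a small rectangle around a given point contains at most that one,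
    and [bisection] covers the square. Finiteness gives the sum in [pole_count] its meaning and
    leaves only finitely many radii to avoid. *)
Lemma singular_finite f r : meromorphic f -> 0 <= r ->
  finite_set ([set z | nc z <= r] `&` singular f).
Proof.
move=> mf r0.
have : finite_set ([set z | [/\ - r <= Re z <= - r + 2 * r, - r <= Im z <= - r + 2 * r & singular f z]]).
  apply: (@bisection R (fun x y w h : R => finite_set [set z | [/\ x <= Re z <= x + w, y <= Im z <= y + h & singular f z]])).
  - by rewrite mulr_ge0.
  - by rewrite mulr_ge0.
  - move=> x y w h F1 F2 F3 F4.
    apply: (@sub_finite_set _ _ (([set z | [/\ x <= Re z <= x + w / 2, y <= Im z <= y + h / 2 & singular f z]] `|`
       [set z | [/\ x + w / 2 <= Re z <= x + w / 2 + w / 2, y <= Im z <= y + h / 2 & singular f z]]) `|`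
       ([set z | [/\ x <= Re z <= x + w / 2, y + h / 2 <= Im z <= y + h / 2 + h / 2 & singular f z]] `|`
       [set z | [/\ x + w / 2 <= Re z <= x + w / 2 + w / 2, y + h / 2 <= Im z <= y + h / 2 + h / 2 & singular f z]]))); last first.
      by rewrite !finite_setU.
    move=> z [/andP[x1 x2] /andP[y1 y2] sz].
    have xx : x + w / 2 + w / 2 = x + w by rewrite -addrA -splitr.
    have yy : y + h / 2 + h / 2 = y + h by rewrite -addrA -splitr.
    rewrite /= xx yy.
    have [xl|xl] := leP (Re z) (x + w / 2); have [yl|yl] := leP (Im z) (y + h / 2).
    + by left; left; split; rewrite // ?x1 ?y1.
    + by right; left; split; rewrite // ?x1 ?y2 ?(ltW yl).
    + by left; right; split; rewrite // ?x2 ?y1 ?(ltW xl).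
    + by right; right; split; rewrite // ?x2 ?y2 ?(ltW xl) ?(ltW yl).
  - move=> p q _ _; have [d d0 Hd] := meromorphic_isolated mf (p +i* q).
    exists (d / 2); first by rewrite divr_gt0.
    move=> x y w h /andP[p1 p2] /andP[q1 q2] /andP[w0 wd] /andP[h0 hd].
    apply: (@sub_finite_set _ _ [set p +i* q]); last exact: finite_set1.
    move=> z [/andP[x1 x2] /andP[y1 y2] sz] /=; apply: contrapT => zp.
    apply: sz; apply: Hd; first exact/eqP.
    rewrite (le_lt_trans (nc_le_ReIm _))// Re_add Re_opp Im_add Im_opp /= (splitr d) ltrD//.
      by rewrite ltr_norml; apply/andP; split; lra.
    by rewrite ltr_norml; apply/andP; split; lra.
apply: sub_finite_set => z [/= zr sz].
have -> : - r + 2 * r = r by ring.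
by split => //; rewrite -ler_norml (le_trans _ zr)// ?Re_le_nc ?Im_le_nc.
Qed.

(** A sum with infinite support is 0 by convention, so the comparison with the term at 0 rests on
    [singular_finite]. *)
Lemma pole_count_ge0 f t : meromorphic f -> 0 <= t -> 0 <= pole_count f 0 <= pole_count f t.
Proof.
move=> mf t0; apply/andP; split; first by apply: fsumr_ge0 => z _; exact: ler0n.
have -> : pole_count f 0 = (pole_order f 0)%:R.
  rewrite /pole_count (_ : [set z | nc z <= 0] = [set (0 : C)]) ?fsbig_set1//.
  apply/seteqP; split => z /=; last by move=> ->; rewrite nc0.
  by move=> z0; apply/eqP; rewrite -nc_eq0 eq_le z0 nc_ge0.
have [->|p0] := eqVneq (pole_order f 0) 0%N; first by apply: fsumr_ge0 => z _; exact: ler0n.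
rewrite /pole_count fsbig_supp (fsbigD1 0).
- by rewrite lerDl; apply: fsumr_ge0 => z _; exact: ler0n.
- apply: sub_finite_set (singular_finite mf t0) => z [/= zt po]; split => //= hz.
  by apply: po; rewrite pole_order_holo.
- split; first by rewrite /mkset nc0.
  by move=> /eqP; rewrite pnatr_eq0; exact/negP.
Qed.

(** Turns the hypotheses on [T(r, a)] and [T(r, alpha)] into bounds on circle means. The condition
    [1 <= r] makes the term with [ln r] nonnegative. *)
Lemma proximity_le_characteristic f r : meromorphic f -> 1 <= r -> proximity f r <= characteristic f r.
Proof.
move=> mf r1; rewrite lerDl addr_ge0//.
  apply: Rintegral_ge0 => t; rewrite /= in_itv/= => /andP[t0 _].
  have /andP[_ H] := pole_count_ge0 mf (ltW t0).
  by rewrite divr_ge0 ?subr_ge0// ltW.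
by rewrite mulr_ge0 ?ln_ge0//; have /andP[] := pole_count_ge0 mf (lexx 0).
Qed.

Lemma proximityE f r : proximity f r = rmean (ulog f r).
Proof. by []. Qed.
End Poles.

(** * The growth argument *)

Section MainInequality.
Context {R : realType}.
Local Notation C := R[i].
Implicit Types (f g a alpha : C -> C) (r s t : R) (z w beta : C).

(** The ratio tends to 1 as [c] grows. The witness gives [2 * d <= e * (c - d)], so the ratio is at
    most [1 + e], and [(1 + e) ^+ 2 <= 1 + 3 * e <= K] for [e <= 1]. *)
Lemma harnack_constant (K d : R) : 1 < K -> 0 <= d ->
  exists2 c, d < c & ((c + d) / (c - d)) ^+ 2 <= K.
Proof.
move=> K1 d0; pose e := Num.min 1 ((K - 1) / 3).
have e0 : 0 < e by rewrite lt_min ltr01 divr_gt0// subr_gt0.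
have e1 : e <= 1 by rewrite ge_min lexx.
have eK : e <= (K - 1) / 3 by rewrite ge_min lexx orbT.
have q0 : 0 <= 2 * d / e by rewrite divr_ge0 ?mulr_ge0// ltW.
exists (d + 2 * d / e + 1); first by lra.
have -> : d + 2 * d / e + 1 + d = (2 * d / e + 1) + 2 * d by ring.
have -> : d + 2 * d / e + 1 - d = 2 * d / e + 1 by ring.
set q := 2 * d / e in q0 *.
have dE : 2 * d = q * e by rewrite /q divfK// gt_eqF.
have q1 : 0 < q + 1 by rewrite ltr_wpDl.
have b0 : (q + 1 + 2 * d) / (q + 1) <= 1 + e.
  rewrite ler_pdivrMr// dE; lra.
apply: (@le_trans _ _ ((1 + e) ^+ 2)).
  rewrite lerXn2r// nnegrE; last by rewrite addr_ge0// ltW.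
  by rewrite divr_ge0// ?ltW// ltr_wpDr// mulr_ge0.
have : e * e <= 1 * e by rewrite ler_wpM2r// ltW.
rewrite expr2; lra.
Qed.

Lemma log_nderiv_le f k beta r s d c z : centire f -> 0 < s ->
  nc beta + k%:R <= d -> d < c -> nc z + c <= s -> s < r ->
  (forall w, nc w <= s -> nc (f w) <= expR (poisson (ulog f s) r w + 1)) ->
  logp (nc (nderiv k f (z + beta))) <=
    ((c + d) / (c - d)) ^+ 2 * poisson (ulog f s) r z + 1.
Proof.
move=> Ef s0 bd dc zc sr maj.
have d0 : 0 <= d by rewrite (le_trans _ bd)// addr_ge0 ?nc_ge0.
have cu : continuous (ulog f s) by apply: continuous_ulog => t; exact: holo_ccont.
have u0 t : 0 <= ulog f s t by exact: logp_ge0.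
have r0 : 0 < r := lt_trans s0 sr.
have zr : nc z < r by apply: le_lt_trans sr; apply: le_trans zc; rewrite lerDl (le_trans d0)// ltW.
rewrite -[leRHS]logp_expR; last first.
  by rewrite addr_ge0// mulr_ge0 ?sqr_ge0 ?poisson_ge0.
apply: le_logp; apply: nderiv_bound => // w wk.
have wz : nc (w - z) <= d.
  have -> : w - z = (w - (z + beta)) + beta by ring.
  by rewrite (le_trans (ncD _ _))// (le_trans _ bd)// addrC lerD2l.
have ws : nc w <= s.
  rewrite -[w](subrK z) (le_trans (ncD _ _))// (le_trans _ zc)// addrC lerD2l.
  by rewrite (le_trans wz)// ltW.
rewrite (le_trans (maj w ws))// ler_expR lerD2r.
apply: harnack => //; exact: le_trans zc (ltW sr).
Qed.

(** The gap [c] is fixed before the radii, so one gap works along a whole sequence. In the constant,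
    [ln 2] comes from the sum of two terms and 1 from the error of the majorant. *)
Lemma main_inequality f k beta (K : R) : centire f -> 1 < K ->
  exists2 c, 0 < c & forall a alpha r s, 0 <= r -> r + c <= s ->
    (forall z, nc z = r -> [/\ holo a z, holo alpha z & f z ^+ 2 + a z * nderiv k f (z + beta) = alpha z]) ->
    2 * rmean (ulog f r) <= rmean (ulog alpha r) + rmean (ulog a r) + K * rmean (ulog f s) + (ln 2 + 1).
Proof.
move=> Ef K1; pose d := nc beta + k%:R.
have d0 : 0 <= d by rewrite addr_ge0// nc_ge0.
have [c dc cK] := harnack_constant K1 d0.
have c0 : 0 < c := le_lt_trans d0 dc.
exists c => // a alpha r s r0 rs Heq.
have s0 : 0 < s by apply: lt_le_trans rs; rewrite ltr_wpDl.
have [r' sr' maj] := poisson_majorant Ef s0.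
have r'0 : 0 < r' := lt_trans s0 sr'.
have rr' : 0 <= r < r'.
  rewrite r0 /=; apply: le_lt_trans sr'; apply: le_trans rs; rewrite lerDl; exact: ltW.
have cu : continuous (ulog f s) by apply: continuous_ulog => t; exact: holo_ccont.
have u0 t : 0 <= ulog f s t by exact: logp_ge0.
have cf : continuous (ulog f r) by apply: continuous_ulog => t; exact: holo_ccont.
have ca : continuous (ulog a r).
  by apply: continuous_ulog => t; apply: holo_ccont; have [] := Heq _ (nc_circ t r0).
have cal : continuous (ulog alpha r).
  by apply: continuous_ulog => t; apply: holo_ccont; have [] := Heq _ (nc_circ t r0).
have cp : continuous (fun t => poisson (ulog f s) r' (circ r t)) by exact: continuous_poisson.
have cKp : continuous (fun t => K * poisson (ulog f s) r' (circ r t)).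
  by move=> t; apply: cvgM; [exact: cvg_cst|exact: cp].
have caa : continuous (fun t => ulog alpha r t + ulog a r t).
  by move=> t; apply: cvgD; [exact: cal|exact: ca].
have caaK : continuous (fun t => ulog alpha r t + ulog a r t + K * poisson (ulog f s) r' (circ r t)).
  by move=> t; apply: cvgD; [exact: caa|exact: cKp].
have cc : continuous (fun _ : R => ln 2 + 1 : R) by move=> t; exact: cvg_cst.
(* The mean at radius [s] becomes a mean of the majorant at radius [r], so that a pointwise
   inequality on one circle suffices. *)
rewrite -(poisson_mean cu r'0 rr') -[ln 2 + 1]rmean_cst -!rmeanZ//.
rewrite -rmeanD// -rmeanD// -rmeanD//.
apply: le_rmean.
- by move=> t; apply: cvgM; [exact: cvg_cst|exact: cf].
- by move=> t; apply: cvgD; [exact: caaK|exact: cc].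
move=> t; have zr := nc_circ t r0; set z := circ r t in zr *.
have [_ _ E] := Heq z zr.
have zc : nc z + c <= s by rewrite zr.
have D := log_nderiv_le Ef s0 (lexx d) dc zc sr' maj.
have P0 : 0 <= poisson (ulog f s) r' z.
  by apply: poisson_ge0 => //; rewrite zr; case/andP: rr'.
have {}D : logp (nc (nderiv k f (z + beta))) <= K * poisson (ulog f s) r' z + 1.
  by rewrite (le_trans D)// lerD2r ler_wpM2r.
rewrite -logpX2 ?nc_ge0// -ncX.
have -> : f z ^+ 2 = alpha z - a z * nderiv k f (z + beta) by rewrite -E addrK.
apply: (le_trans (le_logp (ncB _ _))).
apply: (le_trans (logpD (nc_ge0 _) (nc_ge0 _))); rewrite ncM.
have := logpM (nc_ge0 (a z)) (nc_ge0 (nderiv k f (z + beta))).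
rewrite /ulog -/z; move: D; lra.
Qed.

(** Means bounded along radii tending to infinity would bound [f] everywhere: on the disc of half
    the radius Harnack's factor is [3 ^+ 2 = 9]. Liouville's theorem then makes [f] a constant
    polynomial. *)
Lemma mean_ulog_unbounded f (M : R) : centire f -> ~ (exists p : {poly C}, forall z, f z = p.[z]) ->
  forall s : nat -> R, (forall x, exists n, x < s n) -> exists n, M < rmean (ulog f (s n)).
Proof.
move=> Ef np s sinf; apply: contrapT => Hno; apply: np.
have M' n : rmean (ulog f (s n)) <= M by rewrite leNgt; apply/negP => ?; apply: Hno; exists n.
exists (f 0)%:P => z; rewrite hornerC.
apply: (liouville (B := expR (9 * M + 1)) Ef) => w.
have [n sn] := sinf (2 * nc w).
have s0 : 0 < s n by rewrite (le_lt_trans _ sn)// mulr_ge0// nc_ge0.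
have [r sr maj] := poisson_majorant Ef s0.
have r0 : 0 < r := lt_trans s0 sr.
have cu : continuous (ulog f (s n)) by apply: continuous_ulog => t; exact: holo_ccont.
have u0 t : 0 <= ulog f (s n) t by exact: logp_ge0.
have ws : nc w <= s n / 2 by rewrite ler_pdivlMr// mulrC ltW.
have s2 : s n / 2 < s n by rewrite ltr_pdivrMr// ltr_pMr// ltr1n.
rewrite (le_trans (maj w (le_trans ws (ltW s2))))// ler_expR lerD2r.
have H := harnack cu u0 r0 (z := 0) (w := w) (d := s n / 2) (c := s n).
rewrite nc0 add0r subr0 poisson0// in H.
apply: le_trans (H (ltW sr) _ s2 ws) _; first by rewrite divr_ge0// ltW.
have -> : (s n + s n / 2) / (s n - s n / 2) = 3.
  have -> : s n - s n / 2 = s n / 2 by lra.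
  by field; exact: lt0r_neq0.
have -> : 3 ^+ 2 = 9 :> R by ring.
by rewrite ler_wpM2l.
Qed.

Lemma order_bound f : centire f -> (order_of_growth f < +oo)%E ->
  exists M : R, \forall r \near +oo%R, rmean (ulog f r) <= expR (M * ln r).
Proof.
move=> Ef; rewrite /order_of_growth limf_esupE => /ereal_inf_lt[_ [V V1 <-]] Voo.
have [M HM] : exists M : R, (ereal_sup [set (logp (characteristic f r) / ln r)%:E | r in V] <= M%:E)%E.
  move: Voo; case: ereal_sup => [M _|//|_]; first by exists M.
  by exists 0; exact: leNye.
exists M; near=> r.
have Vr : V r by near: r.
have r1 : 1 < r by near: r; exact: nbhs_pinfty_gt.
have := le_trans (ereal_sup_ubound (ex_intro2 _ _ r Vr erefl)) HM.
rewrite lee_fin ler_pdivrMr ?ln_gt0// characteristic_entire// => H.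
by apply: le_trans (le_expR_logp _) _; rewrite ler_expR.
Unshelve. all: by end_near. Qed.

(** Used with the exceptional set as [E] and the radii of singular points as [F]. *)
Lemma exists_outside (E F : set R) (A L : R) : measurable E -> (lebesgue_measure E < L%:E)%E ->
  finite_set F -> 0 < L -> exists2 x, A <= x <= A + L & ~ E x /\ ~ F x.
Proof.
move=> mE EL fF L0; apply: contrapT => Hno.
have sub : `[A, A + L] `<=` E `|` F.
  move=> x; rewrite /= in_itv /= => xA; apply: contrapT => /not_orP[nE nF].
  by apply: Hno; exists x.
have cF : countable F by exact: finite_set_countable.
have mF : measurable F by apply: countable_measurable => // t; exact: measurable_set1.
have le : (lebesgue_measure `[A, (A + L)%R] <= lebesgue_measure (E `|` F))%E.
  apply: le_measure => //; rewrite inE; first exact: measurable_itv.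
  exact: measurableU.
have LE : lebesgue_measure (`[A, A + L] : set R) = L%:E.
  by rewrite lebesgue_measure_itv /= lte_fin ltrDl L0 -EFinD addrAC subrr add0r.
move: le; rewrite LE; apply/negP; rewrite -ltNge.
apply: (@le_lt_trans _ _ (lebesgue_measure E + lebesgue_measure F)%E); first exact: measureU2.
by rewrite [X in (_ + X)%E](countable_lebesgue_measure0 cF) adde0.
Qed.

Lemma exp_beats_poly (K A B M : R) : 1 < K -> 0 <= A -> 1 <= B ->
  exists m : nat, expR (M * ln (A * m%:R + B)) < K ^+ m.
Proof.
move=> K1 A0 B1; pose l := ln K; have l0 : 0 < l by rewrite ln_gt0.
pose N := `|M| + 1; have N0 : 0 < N by rewrite ltr_wpDl.
have AB0 : 0 <= A + B by rewrite addr_ge0// (le_trans ler01).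
(* Beyond this threshold [(m * l) ^+ 2] exceeds [4 * N ^+ 2 * (A + B) * m], which bounds
   [(N * ln y) ^+ 2] once [ln y ^+ 2 <= 4 * y] is known. *)
pose x := 4 * N ^+ 2 * (A + B) / l ^+ 2.
have x0 : 0 <= x by rewrite divr_ge0 ?sqr_ge0// mulr_ge0// mulr_ge0 ?sqr_ge0.
pose m := (Num.bound x).+1.
have mx : x < m%:R by rewrite (lt_trans (archi_boundP x0))// ltr_nat.
have m1 : (1 : R) <= m%:R by rewrite ler1n.
exists m.
set y := A * _ + B.
have y1 : 1 <= y by rewrite (le_trans B1)// lerDr mulr_ge0.
have yb : y <= (A + B) * m%:R.
  by rewrite /y mulrDl lerD2l ler_peMr// (le_trans ler01).
have K0 : 0 < K := lt_trans ltr01 K1.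
have -> : K ^+ m = expR (m%:R * l) by rewrite -[K in LHS](lnK K0) -expRM_natl.
rewrite ltr_expR.
have v0 : 0 <= ln y by rewrite ln_ge0.
(* From [1 + v <= expR v] at [v = ln y / 2]. *)
have vy : ln y ^+ 2 <= 4 * y.
  have y0 : 0 < y := lt_le_trans ltr01 y1.
  rewrite -[in leRHS](lnK y0); have := expR_ge1Dx (ln y / 2).
  have -> : expR (ln y) = expR (ln y / 2) ^+ 2 by rewrite -expRM_natl mulrC divfK.
  set E := expR _ => HE; have : (ln y / 2) ^+ 2 <= E ^+ 2.
    by rewrite lerXn2r ?nnegrE ?expR_ge0 ?divr_ge0// (le_trans _ HE)// lerDr.
  rewrite expr_div_n; lra.
have Mv : M * ln y <= N * ln y by rewrite ler_wpM2r// /N (le_trans (ler_norm _))// lerDl.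
apply: le_lt_trans Mv _; rewrite ltNge; apply/negP => H.
have H2 : (m%:R * l) ^+ 2 <= (N * ln y) ^+ 2.
  by rewrite lerXn2r// nnegrE mulr_ge0// ltW.
have H3 : (m%:R * l) ^+ 2 <= 4 * N ^+ 2 * (A + B) * m%:R.
  apply: (le_trans H2); rewrite exprMn.
  apply: (@le_trans _ _ (N ^+ 2 * (4 * y))); first by rewrite ler_wpM2l ?sqr_ge0.
  apply: (@le_trans _ _ (N ^+ 2 * (4 * ((A + B) * m%:R)))); last by lra.
  by rewrite ler_wpM2l ?sqr_ge0// ler_wpM2l.
move: mx; rewrite ltr_pdivrMr ?exprn_gt0// ltNge => /negP; apply.
rewrite -(ler_pM2l (lt_le_trans ltr01 m1)); move: H3; rewrite exprMn expr2; lra.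
Qed.

Lemma growth_contradiction (V : R -> R) (s : nat -> R) (K A B M c : R) :
  1 < K -> 0 <= A -> 1 <= B ->
  (forall n, 1 <= s n <= A * n%:R + B) ->
  (forall n, V (s n) + c <= expR (M * ln (s n))) ->
  (forall n, K * V (s n) <= V (s n.+1)) -> 0 <= c ->
  ~ exists n, 1 <= V (s n).
Proof.
move=> K1 A0 B1 sb Vb VK c0 [n Vn].
have K0 : 0 <= K by rewrite (le_trans ler01)// ltW.
have G m : K ^+ m <= V (s (n + m)%N).
  elim: m => [|m IHm]; first by rewrite expr0 addn0.
  by rewrite exprS addnS (le_trans _ (VK _))// ler_wpM2l.
have B1' : 1 <= A * n%:R + B by rewrite (le_trans B1)// lerDr mulr_ge0.
(* The starting index [n] is absorbed into the constant term of the linear bound; the absolute value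
   of [M] makes the exponent monotone in the radius. *)
have [j Hj] := exp_beats_poly `|M| K1 A0 B1'.
suff : K ^+ j <= expR (`|M| * ln (A * j%:R + (A * n%:R + B))) by rewrite leNgt Hj.
apply: le_trans (G j) _.
have /andP[s1 s2] := sb (n + j)%N.
have VM : V (s (n + j)%N) <= expR (M * ln (s (n + j)%N)).
  by apply: le_trans (Vb (n + j)%N); rewrite lerDl.
apply: (le_trans VM); rewrite ler_expR.
apply: (@le_trans _ _ (`|M| * ln (s (n + j)%N))).
  by rewrite ler_wpM2r ?ln_ge0// ler_norm.
have sp : 0 < s (n + j)%N := lt_le_trans ltr01 s1.
rewrite ler_wpM2l// ler_ln ?posrE//; last first.
  by rewrite (lt_le_trans ltr01)// (le_trans B1')// lerDr mulr_ge0.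
by move: s2; rewrite natrD mulrDr addrAC addrC.
Qed.
End MainInequality.

Theorem theorem3 (R : realType) (k : nat) (beta : R[i]) (gamma : R)
    (hgamma : 0 <= gamma < 1) (a alpha : R[i] -> R[i])
    (ha : meromorphic a) (halpha : meromorphic alpha) :
  ~ exists f : R[i] -> R[i],
      [/\ transcendental_entire f,
          (order_of_growth f < +oo)%E,
          forall z : R[i], holomorphic_at a z -> holomorphic_at alpha z ->
            f z ^+ 2 + a z * nderiv k f (z + beta) = alpha z,
          small_function f a &
          is_S f (fun r : R => characteristic alpha r - gamma * characteristic f r)].
Proof.
move=> [f [[/entire_centire Ef np] ord eqn [_ [E1 [mE1 E1oo S1]]] [E2 [mE2 E2oo S2]]]].
have [M HM] := order_bound Ef ord.
case/andP: hgamma => g0 g1.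
(* [e] and [K] are such that [K ^+ 2 <= 2 - gamma - 2 * e]. *)
pose d := 1 - gamma; have d0 : 0 < d by rewrite subr_gt0.
have d1 : d <= 1 by rewrite lerBlDr lerDl.
pose e := d / 8; have e0 : 0 < e by rewrite divr_gt0.
pose K := 1 + d / 4; have K1 : 1 < K by rewrite ltrDl divr_gt0.
have [c c0 ineq] := main_inequality k beta Ef K1.
pose U r := rmean (ulog f r).
have U0 r : 0 <= U r by apply: rmean_ge0 => t; exact: logp_ge0.
have TU r : characteristic f r = U r by exact: characteristic_entire.
(* The exceptional set has finite measure, so every interval of length [L] leaves it. *)
pose E := E1 `|` E2; have mE : measurable E := measurableU _ _ mE1 mE2.
have Eoo : (lebesgue_measure E < +oo)%E.
  apply: (@le_lt_trans _ _ (lebesgue_measure E1 + lebesgue_measure E2)%E); first exact: measureU2.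
  exact: lte_add_pinfty.
pose mu := fine (lebesgue_measure E).
have Efin : lebesgue_measure E = mu%:E.
  by rewrite /mu fineK// ge0_fin_numE// measure_ge0.
have mu0 : 0 <= mu by rewrite fine_ge0.
(* The summand [c] concerns the gaps: the intervals of length [L] chosen below start [2 * L] apart,
   so radii from consecutive ones differ by at least [c]. *)
pose L := mu + c + 1.
have L0 : 0 < L by rewrite ltr_pwDr// addr_ge0// ltW.
have cL : c <= L by rewrite /L; lra.
have EL : (lebesgue_measure E < L%:E)%E by rewrite Efin lte_fin /L; lra.
have [r1 r1real Hr1] : exists2 r1 : R, 1 <= r1 & forall r, r1 <= r ->
   [/\ U r <= expR (M * ln r), ~ E1 r -> characteristic a r <= e * U r &
     ~ E2 r -> characteristic alpha r <= (gamma + e) * U r].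
  have [b [_ Hb]] := filterI HM (filterI (S1 e e0) (S2 e e0)).
  exists (Num.max 1 (b + 1)); first by rewrite le_max lexx.
  move=> r; rewrite ge_max => /andP[_ br].
  have [h1 [h2 h3]] := Hb r (lt_le_trans (ltr_pwDr ltr01 (lexx b)) br).
  rewrite TU (ger0_norm (U0 r)) in h2 h3.
  split => // nE; first by rewrite (le_trans (ler_norm _))// h2.
  have := le_trans (ler_norm _) (h3 nE); rewrite lerBlDr mulrDl addrC; exact.
(* The equation is available only where [a] and [alpha] are holomorphic, so these radii are avoided
   to have it on a whole circle. *)
pose F n := [set nc z | z in ([set z | nc z <= r1 + 2 * L * n%:R + L] `&` (singular a `|` singular alpha))].
have fF n : finite_set (F n).
  have rad0 : 0 <= r1 + 2 * L * n%:R + L.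
    have := mulr_ge0 (ltW L0) (ler0n R n); move: r1real (ltW L0).
    rewrite -[2 * L * _]mulrA; lra.
  by apply: finite_image; rewrite setIUr finite_setU; split; exact: singular_finite.
have ex n : exists x, r1 + 2 * L * n%:R <= x <= r1 + 2 * L * n%:R + L /\ (~ E x /\ ~ F n x).
  by have [x] := exists_outside (r1 + 2 * L * n%:R) mE EL (fF n) L0; exists x.
have [s Hs] := choice ex.
have s1 n : r1 <= s n.
  by have [/andP[h _] _] := Hs n; apply: le_trans h; rewrite lerDl !mulr_ge0// ltW.
have sc n : s n + c <= s n.+1.
  have [/andP[_ h] _] := Hs n; have [/andP[h' _] _] := Hs n.+1.
  apply: le_trans h'; rewrite -natr1; move: h cL; lra.
have good n z : nc z = s n -> holomorphic_at a z /\ holomorphic_at alpha z.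
  have [/andP[_ h] [_ nF]] := Hs n; move=> zs.
  by split; apply: contrapT => nh; apply: nF; exists z => //; split; rewrite /= ?zs//; [left|right].
have step n : (2 - gamma - 2 * e) * U (s n) <= K * U (s n.+1) + (ln 2 + 1).
  have sn0 : 0 <= s n by rewrite (le_trans _ (s1 n))// (le_trans ler01).
  have sn1 : 1 <= s n by rewrite (le_trans r1real).
  have I := ineq a alpha (s n) (s n.+1) sn0 (sc n).
  have {}I := I (fun z zs => let: conj h1 h2 := good n z zs in
     And3 (holomorphic_at_holo h1) (holomorphic_at_holo h2) (eqn z h1 h2)).
  have [_ ta tal] := Hr1 _ (s1 n).
  have [_ [/not_orP[nE1 nE2] _]] := Hs n.
  have pa := le_trans (proximity_le_characteristic ha sn1) (ta nE1).
  have pal := le_trans (proximity_le_characteristic halpha sn1) (tal nE2).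
  rewrite !proximityE in pa pal.
  rewrite /U in pa pal *; move: I pa pal; lra.
have ln2 : 0 <= ln 2 :> R by rewrite ln_ge0// ler1n.
(* Subtracting [D] absorbs the additive constant: the recursion for [U - D] holds with a surplus of
   [(K - 1) ^+ 2 * D]. *)
pose D := (ln 2 + 1) / (K - 1).
have K10 : 0 < K - 1 by rewrite subr_gt0.
have D0 : 0 <= D := divr_ge0 (addr_ge0 ln2 ler01) (ltW K10).
have DE : D * (K - 1) = ln 2 + 1 by rewrite /D divfK// gt_eqF.
(* The left side is [1 + d / 2 + d ^+ 2 / 16], the right side [1 + 3 * d / 4], and [d <= 1]. *)
have KK : K * K <= 2 - gamma - 2 * e.
  have dd : d * d <= d by rewrite ler_piMr// ltW.
  by rewrite /K /e; move: dd; rewrite /d; lra.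
have step' n : K * (U (s n) - D) <= U (s n.+1) - D.
  have K0 : 0 < K := lt_trans ltr01 K1.
  have := step n; have := ler_wpM2r (U0 (s n)) KK => h1 h2.
  rewrite -(ler_pM2l K0).
  have q : 0 <= (K - 1) * (K - 1) * D := mulr_ge0 (mulr_ge0 (ltW K10) (ltW K10)) D0.
  have h3 := le_trans h1 h2; rewrite -DE in h3.
  rewrite -subr_ge0 in h3; rewrite -subr_ge0.
  have -> : K * (U (s n.+1) - D) - K * (K * (U (s n) - D)) =
    (K * U (s n.+1) + D * (K - 1) - K * K * U (s n)) + (K - 1) * (K - 1) * D by ring.
  exact: addr_ge0.
have sub n : 1 <= s n <= (2 * L) * n%:R + (r1 + L).
  rewrite (le_trans r1real)//=; have [/andP[_ h] _] := Hs n.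
  by move: h; lra.
apply: (@growth_contradiction R (fun r => U r - D) s K (2 * L) (r1 + L) M D K1) => //.
- by rewrite mulr_ge0// ltW.
- by rewrite (le_trans r1real)// lerDl ltW.
- by move=> n; rewrite subrK; have [] := Hr1 _ (s1 n).
(* The iteration starts at a radius where [U - D] is at least 1. *)
have [|n Hn] := @mean_ulog_unbounded R f (D + 1) Ef np s.
  move=> x; exists (Num.bound (`|x| / (2 * L))).
  have [/andP[h _] _] := Hs (Num.bound (`|x| / (2 * L))).
  have L2 : 0 < 2 * L by rewrite mulr_gt0.
  have := archi_boundP (divr_ge0 (normr_ge0 x) (ltW L2)).
  rewrite ltr_pdivrMr// => h2; apply: lt_le_trans h.
  have := ler_norm x; move: h2 r1real; lra.
by exists n; rewrite lerBrDl ltW.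
Qed.
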